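(* For all integers $1\le k\le n$, \[\underline{H}_{U_{k,n}}(x)=\sum_{j=0}^{k-1}\binom{n}{j}d_j(x)\bigl(1+x+\cdots+x^{k-1-j}\bigr),\qquad H_{U_{k,n}}(x)=1+x\sum_{j=0}^{k-1}\binom{n}{j}A_j(x)\bigl(1+x+\cdots+x^{k-1-j}\bigr).\]
   Context: $U_{k,n}$ is the uniform matroid of rank $k$ on $[n]$ (bases: all $k$-subsets). Eulerian polynomials: $A_0(x)=1$, $A_n(x)=\sum_{\sigma\in\mathfrak{S}_n}x^{\mathrm{des}(\sigma)}$ for $n\ge1$, with $\mathrm{des}(\sigma)=|\{i\in[n-1]:\sigma_i>\sigma_{i+1}\}|$. Derangement polynomials: $d_0(x)=1$ and $d_n(x)=\sum_{\sigma}x^{\mathrm{exc}(\sigma)}$ for $n\ge1$, the sum over permutations $\sigma\in\mathfrak{S}_n$ without fixed points, with $\mathrm{exc}(\sigma)=|\{i:\sigma_i>i\}|$. For a loopless matroid $M$ on $E$ with lattice of flats $\mathcal{L}(M)$: $\underline{\mathrm{CH}}(M)=\mathbb{Q}[x_F: F\in\mathcal{L}(M)\setminus\{\varnothing,E\}]/(I+J)$, $I$ generated by $x_{F_1}x_{F_2}$ for incomparable $F_1,F_2$, $J$ by $\sum_{F\ni i}x_F-\sum_{F\ni j}x_F$ for $i,j\in E$; and $\mathrm{CH}(M)=\mathbb{Q}[x_F,y_i: F\in\mathcal{L}(M)\setminus\{E\},\, i\in E]/(I'+J')$, $I'$ generated by $y_i-\sum_{F\not\ni i}x_F$, $J'$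 by $x_{F_1}x_{F_2}$ for incomparable $F_1,F_2$ and $y_ix_F$ for $i\notin F$. All variables of degree $1$; $\underline{H}_M(x)$ and $H_M(x)$ are the respective Hilbert series $\sum_j\dim_{\mathbb{Q}}(\cdot)^j x^j$. *)

(* Defs.v *)
From HB Require Import structures.
From mathcomp Require Import all_boot all_order all_algebra all_fingroup.
From mathcomp Require Import mpoly.
Set Implicit Arguments. Unset Strict Implicit. Unset Printing Implicit Defensive.
Import Order.TTheory GRing.Theory Num.Theory.
Local Open Scope ring_scope.

Definition uniform_bases (k n : nat) : {set {set 'I_n}} :=
  [set B : {set 'I_n} | #|B| == k].

Definition mrank n (B : {set {set 'I_n}}) (S : {set 'I_n}) : nat :=
  (\max_(X in B) #|S :&: X|)%N.

Definition is_flat n (B : {set {set 'I_n}}) (F : {set 'I_n}) : bool :=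
  [forall e, (e \notin F) ==> (mrank B F < mrank B (e |: F))%N].

Definition incomparable n (F G : {set 'I_n}) : bool :=
  ~~ (F \subset G) && ~~ (G \subset F).

Definition in_ideal m (S : {mpoly rat[m]} -> Prop) (p : {mpoly rat[m]}) : Prop :=
  exists s : seq ({mpoly rat[m]} * {mpoly rat[m]}),
    (forall t, t \in s -> S t.1) /\ p = \sum_(t <- s) t.1 * t.2.

(* dim_Q of the degree-j part of Q[x_1..x_m]/(S) (S consisting of homogeneous
   generators, all variables of degree 1) equals d: there are d homogeneous
   polynomials of degree j whose classes form a basis of that graded piece. *)
Definition graded_dim m (S : {mpoly rat[m]} -> Prop) (j d : nat) : Prop :=
  exists b : 'I_d -> {mpoly rat[m]},
    [/\ forall t, b t \is j.-homog,
        forall p : {mpoly rat[m]}, p \is j.-homog ->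
          exists c : 'I_d -> rat, in_ideal S (p - \sum_t c t *: b t)
      & forall c : 'I_d -> rat, in_ideal S (\sum_t c t *: b t) -> forall t, c t = 0].

Definition pflats n (B : {set {set 'I_n}}) : {set {set 'I_n}} :=
  [set F | is_flat B F & (F != set0) && (F != setT)].

Definition pflat n (B : {set {set 'I_n}}) (i : 'I_#|pflats B|) : {set 'I_n} :=
  enum_val i.

Definition red_gens n (B : {set {set 'I_n}}) (p : {mpoly rat[#|pflats B|]}) : Prop :=
  (exists i j, incomparable (pflat i) (pflat j) /\ p = 'X_i * 'X_j)
  \/ (exists a b : 'I_n,
        p = \sum_(i | a \in pflat i) 'X_i - \sum_(i | b \in pflat i) 'X_i).

Definition aflats n (B : {set {set 'I_n}}) : {set {set 'I_n}} :=
  [set F | is_flat B F & F != setT].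

Definition aflat n (B : {set {set 'I_n}}) (i : 'I_#|aflats B|) : {set 'I_n} :=
  enum_val i.

Definition xv n (B : {set {set 'I_n}}) (i : 'I_#|aflats B|)
  : {mpoly rat[#|aflats B| + n]} := 'X_(lshift n i).
Definition yv n (B : {set {set 'I_n}}) (a : 'I_n)
  : {mpoly rat[#|aflats B| + n]} := 'X_(rshift #|aflats B| a).

Definition aug_gens n (B : {set {set 'I_n}}) (p : {mpoly rat[#|aflats B| + n]}) : Prop :=
  (exists a : 'I_n, p = yv B a - \sum_(i | a \notin aflat i) xv i)
  \/ (exists i j, incomparable (aflat i) (aflat j) /\ p = xv i * xv j)
  \/ (exists (a : 'I_n) i, a \notin aflat i /\ p = yv B a * xv i).

(* descents, 0-indexed: positions i with i+1 < n and s i > s (i+1) *)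
Definition des n (s : 'S_n) : nat :=
  #|[set p : 'I_n * 'I_n | (p.2 == p.1.+1 :> nat) && (s p.2 < s p.1)%N]|.

Definition exc n (s : 'S_n) : nat := #|[set i : 'I_n | (i < s i)%N]|.

(* A_n(x); for n = 0 the sum has one term and equals 1 *)
Definition eulerian (n : nat) : {poly rat} := \sum_(s : 'S_n) 'X^(des s).

(* d_n(x); for n = 0 the sum has one term and equals 1 *)
Definition derangement (n : nat) : {poly rat} :=
  \sum_(s : 'S_n | [forall i, s i != i]) 'X^(exc s).

Definition geom (r : nat) : {poly rat} := \sum_(i < r) 'X^i.

Arguments red_gens {n} B p.
Arguments aug_gens {n} B p.

(* Main.v *)
(** Idea. In the presentation with one variable x_F for every nonempty flat, the
    ground set E included, put h_S = sum_{F >= S} x_F. The Chow relations imply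
    x_F h_G^(rk G - rk F) = 0 for F < G and h_G^(rk G) = 0. Adjoining the
    variables one flat F at a time, from E downwards, x_F satisfies the monic
    equation (x_F + sum_{G > F} x_G)^(rk F) = 0 and is annihilated by the
    relations of the filter of flats above F. Hence the monomials
    x_{F_1}^{a_1} ... x_{F_r}^{a_r} with F_1 < ... < F_r and
    0 < a_i < rk F_i - rk F_{i-1} span, and each admits a dual functional on the
    polynomial ring that vanishes on the ideal, built by the same recursion.
    The augmented ring of U_{k,n} satisfies the relations of the flats through a
    fixed extra point in U_{k+1,n+1}.

    Counting these monomials by their smallest flat gives a recursion in (k, n).
    It matches the formula because
    d_t = sum_{j<t} C(t,j) d_j (x + ... + x^(t-j-1)), which follows from
    sum_s x^wexc(s) = x sum_s x^exc(s) after multiplication by x - 1, and because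
    A_t = sum_j C(t,j) d_j, as des and exc are equidistributed. *)

Require Import Defs.
From HB Require Import structures.
From mathcomp Require Import all_boot all_order all_algebra all_fingroup.
From mathcomp Require Import mpoly.
From mathcomp Require Import zify ring.
Set Implicit Arguments. Unset Strict Implicit. Unset Printing Implicit Defensive.
Import GRing.Theory Pdiv.CommonRing Pdiv.RingMonic.
Local Open Scope ring_scope.

(** * Relations among the variables of flats *)

(** No quotient ring is formed: an ideal is a predicate, and the one notion [fy_rel] is applied to
    the ideal of the presentation, for spanning, and to [kills lam], for independence. The linear
    relations sum over all flats through a point and so do not restrict to fewer flats. The power
    relations do: if S lies in a filter P of flats, h_S involves only variables of P. The delicate
    point is to add x_F without collapsing the smaller ring. With c = rk F - rk F0 the new ring
    should be the direct sum A + x_F A_F + ... + x_F^(c-1) A_F, where A belongs to P without F and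
    A_F to the filter above F. Multiplication by x_F carries the top summand back into A through
    x_F^c = - h^c - ..., with h the sum of x_G over G > F. This is consistent only if each relation
    of A_F becomes one of A after multiplication by h^c, which is the content of [rel0_out] and
    [rel0_above]; [rel0_weaken] makes A_F a quotient of A. *)

Section Ideals.
Variables (R : comNzRingType) (I : R -> Prop).

Definition is_ideal :=
  [/\ I 0, forall p q, I p -> I q -> I (p + q) & forall p q, I p -> I (p * q)].

Hypothesis idI : is_ideal.

Lemma ideal_mem0 : I 0. Proof. by case: idI. Qed.

Lemma ideal_add p q : I p -> I q -> I (p + q).
Proof. by case: idI => _ h _; exact: h. Qed.

Lemma ideal_mulr p q : I p -> I (p * q).
Proof. by case: idI => _ _; exact. Qed.

Lemma ideal_mull p q : I q -> I (p * q).
Proof. by rewrite mulrC; exact: ideal_mulr. Qed.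

Lemma ideal_opp p : I p -> I (- p).
Proof. by rewrite -mulN1r; exact: ideal_mull. Qed.

Lemma ideal_sub p q : I p -> I q -> I (p - q).
Proof. by move=> Ip /ideal_opp; exact: ideal_add. Qed.

Lemma ideal_sum (J : Type) (r : seq J) (P : pred J) (f : J -> R) :
  (forall j, P j -> I (f j)) -> I (\sum_(j <- r | P j) f j).
Proof. by move=> If; apply: big_ind => //; [exact: ideal_mem0 | exact: ideal_add]. Qed.

Lemma ideal_congr p q : I (p - q) -> I q -> I p.
Proof. by move=> Ipq Iq; rewrite -[p](subrK q); exact: ideal_add. Qed.

Lemma idealMX_congr a p q e : I (a * (p - q)) -> I (a * q ^+ e) -> I (a * p ^+ e).
Proof.
move=> Ipq; apply: ideal_congr; rewrite -mulrBr subrXX mulrA.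
exact: ideal_mulr.
Qed.

Lemma idealMX_le a p m e : (m <= e)%N -> I (a * p ^+ m) -> I (a * p ^+ e).
Proof. by move=> /subnKC <-; rewrite exprD mulrA; exact: ideal_mulr. Qed.

Lemma idealX_congr p q e : I (p - q) -> I (q ^+ e) -> I (p ^+ e).
Proof.
rewrite -[p - q]mul1r -[q ^+ e]mul1r -[p ^+ e]mul1r; exact: idealMX_congr.
Qed.

Lemma idealX_le p m e : (m <= e)%N -> I (p ^+ m) -> I (p ^+ e).
Proof. by move=> le; rewrite -[p ^+ m]mul1r -[p ^+ e]mul1r; exact: idealMX_le. Qed.

End Ideals.

(** With [x = xi F] this colon ideal carries the relations of the filter above F: the powers of
    [hsum] with exponents counted from F vanish only after multiplication by [xi F]. *)
Lemma ideal_colon (R : comNzRingType) (I : R -> Prop) x :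
  is_ideal I -> is_ideal (fun p => I (x * p)).
Proof.
move=> idI; split=> [|p q Ip Iq|p q Ip]; first by rewrite mulr0; exact: ideal_mem0.
  by rewrite mulrDr; exact: ideal_add.
by rewrite mulrA; exact: ideal_mulr.
Qed.

Section Flats.
Variables (T : finType) (k : nat).
Hypothesis kT : (k <= #|T|)%N.
Implicit Types (F G H S : {set T}) (P : {set {set T}}).

(** Flats, rank and closure ([uflat], [rho], [ucl]) of the uniform matroid of rank k on T;
    [mrank_uniform] and [is_flat_uniform] compare them with the general notions. *)
Definition uflat F := (#|F| < k)%N || (F == setT).
Definition rho S := minn #|S| k.
Definition ucl S := if (#|S| < k)%N then S else setT.

Lemma uflat_cl S : uflat (ucl S).
Proof. by rewrite /ucl /uflat; case: ifP => [->//|_]; rewrite eqxx orbT. Qed.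

Lemma sub_ucl S : S \subset ucl S.
Proof. by rewrite /ucl; case: ifP. Qed.

Lemma rho_ucl S : rho (ucl S) = rho S.
Proof. by rewrite /ucl /rho; case: ifP => //; rewrite cardsT; lia. Qed.

Lemma ucl_sub S F : uflat F -> (ucl S \subset F) = (S \subset F).
Proof.
rewrite /ucl /uflat; case: ifP => // Sk /orP[Fk|/eqP->]; last by rewrite !subsetT.
apply/idP/idP => sub; first exact: subset_trans (subsetT _) sub.
by have := subset_leq_card sub; lia.
Qed.

Lemma uflat_proper F G : uflat F -> F \proper G -> (#|F| < k)%N.
Proof. by case/orP=> // /eqP->; rewrite properE subsetT andbF. Qed.

Lemma rhoT : rho setT = k.
Proof. by rewrite /rho cardsT; exact/minn_idPr. Qed.

Lemma rho_proper F : (#|F| < k)%N -> rho F = #|F|.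
Proof. by move=> /ltnW/minn_idPl. Qed.

(** A filter in the lattice of flats, so that [hsum S] for S in P involves only variables of P. *)
Definition up_closed P :=
  (forall F, F \in P -> uflat F) /\
  (forall F G, F \in P -> uflat G -> F \subset G -> G \in P).

Definition incomp F G := ~~ (F \subset G) && ~~ (G \subset F).

Section Relations.
Variables (R : comNzRingType) (I : R -> Prop) (xi : {set T} -> R).
Hypothesis idI : is_ideal I.

Definition hsum S : R := \sum_(H | uflat H && (S \subset H)) xi H.

(* Feichtner-Yuzvinsky relations of the interval above [F0], in the variables
   indexed by [P]. The ground set has its own variable [xi setT], which stands
   for minus the sum of the [xi F] over the proper flats containing a point. *)
Definition fy_rel F0 P :=
  [/\ forall G H, G \in P -> H \in P -> incomp G H -> I (xi G * xi H),
      forall S, S \in P -> I (hsum S ^+ (rho S - rho F0))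
    & forall H S, H \in P -> S \in P -> H \proper S ->
        I (xi H * hsum S ^+ (rho S - rho H))].

Lemma hsum_ucl S : hsum (ucl S) = hsum S.
Proof.
by apply: eq_bigl => H; case fH: (uflat H) => //=; rewrite ucl_sub.
Qed.

(** The dual functionals live on one fixed polynomial ring with a variable for every subset of T, so
    they must annihilate the variables outside P as well. *)
Definition fy_rel0 F0 P := fy_rel F0 P /\ forall G, G \notin P -> I (xi G).

Section Rel0.
Variables (F0 : {set T}) (P : {set {set T}}).
Hypotheses (upP : up_closed P) (rel0 : fy_rel0 F0 P).

Lemma rel0_incomp G H : incomp G H -> I (xi G * xi H).
Proof.
case: rel0 => [[h _ _] h0] inc.
case GP: (G \in P); last by apply/(ideal_mulr idI)/h0; rewrite ?GP.
case HP: (H \in P); last by apply/(ideal_mull idI)/h0; rewrite ?HP.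
exact: h.
Qed.

(** A flat that contains S but not G is incomparable to G, because S is not inside G. So after
    multiplication by [xi G] only the flats above both remain, and the relation for G below the
    closure of their union applies. *)
Lemma rel0_hsumX G S e : G \in P -> ~~ (S \subset G) ->
  (rho (S :|: G) - rho G <= e)%N -> I (xi G * hsum S ^+ e).
Proof.
move=> GP SG le.
have fG : uflat G by apply: (proj1 upP).
apply: (idealMX_congr idI (q := hsum (S :|: G))).
  rewrite /hsum (bigID (fun H => G \subset H)) /=.
  rewrite (eq_bigl (fun H => uflat H && (S :|: G \subset H))); last first.
    by move=> H; rewrite subUset andbA.
  rewrite addrC addrK mulr_sumr; apply: ideal_sum => // H /andP[/andP[fH SH] GH].
  apply: rel0_incomp; rewrite /incomp GH /=; apply: contra SG => HG.
  exact: subset_trans SH HG.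
rewrite -hsum_ucl; apply: (idealMX_le idI le); rewrite -rho_ucl.
have GS : G \subset ucl (S :|: G).
  by apply: subset_trans (sub_ucl _); rewrite subsetUr.
case: rel0 => [[_ _ h] _]; apply: h => //.
  by apply: (proj2 upP) GP (uflat_cl _) GS.
rewrite properE GS /=; apply: contra SG => sub; apply: subset_trans sub.
by apply: subset_trans (sub_ucl _); rewrite subsetUl.
Qed.

End Rel0.

(* Passing from [P :\ F] to [P] mirrors the blow-up along [F]: the new variable
   [xi F] satisfies a monic equation of degree [rho F - rho F0] and is killed by
   the relations of the filter above [F]. *)
Section Step.
Variables (F0 F : {set T}) (P : {set {set T}}).
Hypotheses (upP : up_closed P) (FP : F \in P) (F0F : F0 \proper F)
  (Fmin : forall G, G \in P -> (#|F| <= #|G|)%N)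
  (F0P : forall G, G \in P -> F0 \proper G)
  (uflat_F0 : uflat F0).

Let P' := P :\ F.
Let Q := [set G in P | F \proper G].

Lemma up_closedD1 : up_closed P'.
Proof.
case: upP => fP uP; split=> [G|G H]; first by case/setD1P=> _; exact: fP.
case/setD1P=> nGF GP fH GH; rewrite !inE (uP _ _ GP) // andbT.
apply: contra_neq nGF => HF; apply/eqP.
by rewrite eqEcard -{1}HF GH Fmin.
Qed.

Lemma up_closed_above : up_closed Q.
Proof.
case: upP => fP uP; split=> [G|G H]; first by case/setIdP=> /fP.
case/setIdP=> GP FG fH GH; rewrite inE (uP _ _ GP) //=.
exact: proper_sub_trans FG GH.
Qed.

Definition hsum_gt := \sum_(H | uflat H && (F \proper H)) xi H.

Lemma hsumE : hsum F = xi F + hsum_gt.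
Proof.
rewrite /hsum (bigD1 F) /=; last by rewrite subxx (proj1 upP).
congr (_ + _); apply: eq_bigl => H.
by rewrite properEneq eq_sym -andbA [in RHS](andbC (_ != _)).
Qed.

Lemma card_F0 : (#|F0| < k)%N.
Proof. exact: uflat_proper (uflat_F0) F0F. Qed.

(** Submodularity of the rank, with F0 contained in both F and G. *)
Lemma rho_step G : G \in P -> ~~ (F \subset G) ->
  (rho (F :|: G) - rho G <= rho F - rho F0)%N.
Proof.
move=> GP FG.
have F0G : (#|F0| <= #|F :&: G|)%N.
  by apply/subset_leq_card; rewrite subsetI !proper_sub ?F0P.
have := cardsUI F G; have := card_F0; have := proper_card F0F.
have := subset_leq_card (subsetIr F G).
have: (#|F| < k)%N || (F == setT) := proj1 upP _ FP.
have: (#|G| < k)%N.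
  have := proj1 upP _ GP; case/orP=> // /eqP eG; by rewrite eG subsetT in FG.
have := max_card (mem F); have := Fmin GP.
rewrite /rho; lia.
Qed.

Lemma rel0_hsumF (rel0 : fy_rel0 F0 P') : I (hsum_gt - hsum F).
Proof.
rewrite hsumE opprD addrCA addrN addr0; apply: ideal_opp => //.
by apply: (proj2 rel0); rewrite setD11.
Qed.

(** The degree 0 condition of [ext_killsX] for the relation [xi F * xi G]. As [xi F] is still in I,
    [hsum_gt] may be replaced by [hsum F], and [rho_step] bounds the power that [xi G]
    annihilates. *)
Lemma rel0_out G (rel0 : fy_rel0 F0 P') :
  G \notin Q -> I (xi G * hsum_gt ^+ (rho F - rho F0)).
Proof.
case GP: (G \in P'); last by move=> _; apply/(ideal_mulr idI)/(proj2 rel0); rewrite ?GP.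
move=> nGQ; have /setD1P[nGF GPP] := GP.
have FG : ~~ (F \subset G).
  by apply: contra nGQ => FG; rewrite inE GPP properEneq eq_sym nGF.
apply: (idealMX_congr idI (q := hsum F)).
  by apply: ideal_mull => //; apply: rel0_hsumF.
by apply: (rel0_hsumX up_closedD1 rel0 GP FG); apply: rho_step.
Qed.

(** The degree 0 condition of [ext_killsX] for the relation of S above F. Multiplication by
    [hsum S ^+ (rho S - rho F)] kills [xi H] for each H that contains F but not S, so [hsum_gt] may
    be replaced by [hsum S], and the exponents add up to [rho S - rho F0]. *)
Lemma rel0_above S (rel0 : fy_rel0 F0 P') :
  S \in Q -> I (hsum S ^+ (rho S - rho F) * hsum_gt ^+ (rho F - rho F0)).
Proof.
case/setIdP=> SP FS.
have Fk : (#|F| < k)%N by apply: uflat_proper FS; exact: (proj1 upP).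
have SP' : S \in P' by rewrite !inE SP andbT (contraTneq _ FS) // => ->; rewrite properxx.
apply: (idealMX_congr idI (q := hsum F)).
  by apply: ideal_mull => //; apply: rel0_hsumF.
apply: (idealMX_congr idI (q := hsum S)).
  rewrite /hsum [X in X - _](bigID (fun H => S \subset H)) /=.
  rewrite [X in X + _ - _](eq_bigl (fun H => uflat H && (S \subset H))); last first.
    move=> H; case SH: (S \subset H); rewrite ?andbF // !andbT.
    by rewrite (subset_trans (proper_sub FS) SH) andbT.
  rewrite addrC addKr mulr_sumr; apply: ideal_sum => // H /andP[/andP[fH FH] SH].
  rewrite mulrC; have HP : H \in P by apply: (proj2 upP) FP fH FH.
  case: (eqVneq H F) => [->|nHF].
    by apply/(ideal_mulr idI)/(proj2 rel0) => //; rewrite setD11.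
  have HP' : H \in P' by rewrite !inE nHF.
  apply: (rel0_hsumX up_closedD1 rel0 HP' SH).
  have Hk : (#|H| < k)%N by case/orP: fH => // /eqP eH; rewrite eH subsetT in SH.
  have FI : (#|F| <= #|S :&: H|)%N.
    by apply/subset_leq_card; rewrite subsetI FH (proper_sub FS).
  have := cardsUI S H; have := subset_leq_card (subsetIr S H).
  have := proper_card FS; rewrite /rho; lia.
rewrite -exprD; case: rel0 => [[_ h _] _]; apply: (idealX_le idI _ (h _ SP')).
have := proper_card FS; have := proper_card F0F; rewrite /rho; lia.
Qed.

(** The ring of the filter above F is a quotient of the ring of [P']: the variables not above F
    become zero, and [hsum S] becomes the sum at the closure of F and S, whose relation has a small
    enough exponent by [rho_step]. *)
Lemma rel0_weaken (rel1 : fy_rel0 F Q) : fy_rel0 F0 P'.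
Proof.
have out G : G \notin P' -> I (xi G).
  move=> nG; apply: (proj2 rel1); apply: contra nG => /setIdP[GP FG].
  by rewrite !inE GP andbT (contraTneq _ FG) // => ->; rewrite properxx.
have inQ S : S \in P' -> F \subset S -> S \in Q.
  by case/setD1P=> nSF SP FS; rewrite inE SP properEneq eq_sym nSF.
split=> //; split=> [G H _ _|S|H S HP' SP' HS].
- by apply: (rel0_incomp rel1).
- move=> SP'; have /setD1P[nSF SP] := SP'; case FS: (F \subset S).
    case: rel1 => [[_ h _] _]; apply: (idealX_le idI _ (h _ (inQ _ SP' FS))).
    have := subset_leq_card FS; have := proper_card F0F; rewrite /rho; lia.
  apply: (idealX_congr idI (q := hsum (ucl (F :|: S)))).
    rewrite hsum_ucl /hsum [X in X - _](bigID (fun H => F \subset H)) /=.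
    rewrite [X in X + _ - _](eq_bigl (fun H => uflat H && (F :|: S \subset H))).
      rewrite addrC addKr; apply: ideal_sum => // H /andP[_ FH].
      by apply: (proj2 rel1); rewrite inE properE (negbTE FH) andbF.
    by move=> H; rewrite subUset -andbA [(S \subset _) && _]andbC.
  have FSQ : ucl (F :|: S) \in Q.
    have sF : F \subset ucl (F :|: S).
      by apply: subset_trans (sub_ucl _); rewrite subsetUl.
    rewrite inE (proj2 upP _ _ FP) ?uflat_cl // properEneq sF andbT.
    apply: contraFneq (FS) => eF; have SF : S \subset F.
      by rewrite eF; apply: subset_trans (sub_ucl _); rewrite subsetUr.
    have /eqP-> // : S == F by rewrite eqEcard SF Fmin.
  case: rel1 => [[_ h _] _]; apply: (idealX_le idI _ (h _ FSQ)).
  have := rho_step SP; rewrite FS rho_ucl => /(_ isT).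
  have := Fmin SP; have := proper_card F0F.
  rewrite /rho; have := subset_leq_card (subsetUr F S); lia.
case HQ: (H \in Q); last by apply/(ideal_mulr idI)/(proj2 rel1); rewrite ?HQ.
case: rel1 => [[_ _ h] _]; apply: h => //; apply: inQ SP' _.
by case/setIdP: HQ => _ /proper_sub/subset_trans; apply; exact: proper_sub.
Qed.

End Step.
End Relations.
End Flats.

(** * Independence of the standard monomials *)

(** For additive [lam] this is the largest ideal inside its kernel; it takes the place of I in
    [fy_rel]. *)
Definition kills (B : comNzRingType) (lam : B -> rat) (g : B) :=
  forall q, lam (g * q) = 0.

Definition addfun (B : comNzRingType) (lam : B -> rat) :=
  forall p q, lam (p + q) = lam p + lam q.

Section AdditiveFunctionals.
Variables (B : comNzRingType) (lam : B -> rat).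
Hypothesis addl : addfun lam.

Lemma addfun0 : lam 0 = 0.
Proof. by apply: (addrI (lam 0)); rewrite -addl !addr0. Qed.

Lemma addfunN p : lam (- p) = - lam p.
Proof. by apply/eqP; rewrite -addr_eq0 -addl addNr addfun0. Qed.

Lemma addfunB p q : lam (p - q) = lam p - lam q.
Proof. by rewrite addl addfunN. Qed.

Lemma addfun_sum (J : Type) (r : seq J) (P : pred J) (f : J -> B) :
  lam (\sum_(j <- r | P j) f j) = \sum_(j <- r | P j) lam (f j).
Proof. exact: (big_morph _ addl addfun0). Qed.

Lemma kills_ideal : is_ideal (kills lam).
Proof.
split=> [q|p q kp kq r|p q kp r]; first by rewrite mul0r addfun0.
  by rewrite mulrDl addl kp kq addr0.
by rewrite -mulrA kp.
Qed.

End AdditiveFunctionals.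

Section Extend.
Variables (B : comNzRingType) (c : nat) (h : B) (mu : nat -> B -> rat).
Hypotheses (c_gt0 : (0 < c)%N) (addmu : forall i, addfun (mu i)).

Let M : {poly B} := ('X + h%:P) ^+ c.

(* A functional on [B[X] / (X + h)^c] with prescribed restrictions [mu i] to the
   summands [B X^i], [i < c]. *)
Definition ext (f : {poly B}) : rat := \sum_(i < c) mu i (rmodp f M)`_i.

Let Xh : 'X + h%:P = 'X - (- h)%:P :> {poly B}.
Proof. by rewrite polyCN opprK. Qed.

Let monicM : M \is monic.
Proof. by rewrite /M Xh monic_exp ?monicXsubC. Qed.

Let sizeM : size M = c.+1.
Proof. by rewrite /M Xh size_exp_XsubC. Qed.

Let size_rmod f : (size (rmodp f M) <= c)%N.
Proof. by rewrite -ltnS -sizeM ltn_rmodp monic_neq0. Qed.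

Lemma ext_add : addfun ext.
Proof.
move=> p q; rewrite /ext rmodpD // -big_split /=; apply: eq_bigr => i _.
by rewrite coefD addmu.
Qed.

Lemma ext_mulC a f : ext (a%:P * f) = \sum_(i < c) mu i (a * (rmodp f M)`_i).
Proof.
by rewrite /ext mul_polyC rmodpZ //; apply: eq_bigr => i _; rewrite coefZ.
Qed.

Lemma ext_killsC g : (forall i, kills (mu i) g) -> kills ext g%:P.
Proof. by move=> kg f; rewrite ext_mulC big1 // => i _; exact: kg. Qed.

Lemma ext_killsM : kills ext (('X + h%:P) ^+ c).
Proof.
move=> f; rewrite /ext mulrC rmodp_mull // big1 // => i _.
by rewrite coef0 addfun0.
Qed.

(** Multiplication by X shifts the coefficients of a remainder up by one. The overflow at X^c is
    reduced by the modulus, whose constant term h^c sends it back to degree 0; this is where the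
    condition on [mu 0] comes from. *)
Lemma ext_killsX g : (forall i, (0 < i)%N -> kills (mu i) g) ->
  kills (mu 0) (g * h ^+ c) -> kills ext ('X * g%:P).
Proof.
move=> kg kg0 f; rewrite -mulrA mulrCA ext_mulC.
set r := rmodp f M; have sr : (size r <= c)%N by exact: size_rmod.
have -> : rmodp ('X * f) M = 'X * r - r`_c.-1 *: M.
  have <- : rmodp ('X * r - r`_c.-1 *: M) M = 'X * r - r`_c.-1 *: M; last first.
    by rewrite rmodpB // rmodpZ // rmodpp // scaler0 subr0 rmodp_mulmr.
  apply: rmodp_small.
  rewrite sizeM ltnS; apply/leq_sizeP => j cj.
  rewrite coefB coefZ coefXM; have [->|ncj] := eqVneq j c.
    have -> : M`_c = 1 by move/monicP: monicM; rewrite lead_coefE sizeM.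
    by rewrite gtn_eqF // mulr1 subrr.
  rewrite gtn_eqF; last exact: leq_trans cj.
  have cj' : (c < j)%N by rewrite ltn_neqAle eq_sym ncj.
  rewrite [M`_j]nth_default ?sizeM // mulr0 subr0 nth_default //.
  by rewrite (leq_trans sr) // -ltnS prednK ?(leq_trans _ cj').
rewrite big1 // => -[[|i] ic] _ /=; rewrite coefB coefZ coefXM /=; last first.
  by rewrite kg.
(* The constant coefficient of the modulus is its value at 0, that is h^c. *)
rewrite sub0r -horner_coef0 horner_exp hornerD hornerX hornerC add0r.
by rewrite mulrN mulrCA mulrC -mulrN; exact: kg0.
Qed.

Lemma ext_X i q : (i < c)%N -> ext ('X^i * q%:P) = mu i q.
Proof.
move=> ic; rewrite /ext rmodp_small; last first.
  rewrite sizeM ltnS mulrC mul_polyC (leq_trans (size_scale_leq _ _)) //.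
  by rewrite size_polyXn.
rewrite (bigD1 (Ordinal ic)) //= coefMC coefXn eqxx mul1r big1 ?addr0 // => j nji.
by rewrite coefMC coefXn (_ : _ == _ = false) ?mul0r ?addfun0 //; apply: negbTE.
Qed.

End Extend.

Section Standard.
Variables (T : finType) (k : nat).
Hypothesis kT : (k <= #|T|)%N.
Implicit Types (F G H S : {set T}) (P : {set {set T}}).

Notation N := #|{set T}|.
Notation B := {mpoly rat[N]}.

Definition xvar F : B := 'X_(enum_rank F).
Definition xmon F : 'X_{1..N} := U_(enum_rank F)%MM.

(* Exponents of the Feichtner-Yuzvinsky monomials: along a chain of flats, the
   exponent of each is less than its rank increment. *)
Inductive fy_std : {set T} -> {set {set T}} -> seq 'X_{1..N} -> Prop :=
| fy_std0 F0 : fy_std F0 set0 [:: 0%MM]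
| fy_stdS F0 F P s1 s2 :
    F \in P -> F0 \proper F -> (forall G, G \in P -> #|F| <= #|G|)%N ->
    fy_std F0 (P :\ F) s1 -> fy_std F [set G in P | F \proper G] s2 ->
    fy_std F0 P (s1 ++
      [seq (xmon F *+ i + b)%MM | i <- iota 1 (rho k F - rho k F0).-1, b <- s2]).

Lemma fy_std_exists P F0 : (forall G, G \in P -> F0 \proper G) ->
  exists s, fy_std F0 P s.
Proof.
have [n] := ubnP #|P|; elim: n => // n IHn in P F0 * => ltP F0P.
have [->|[F1 F1P]] := set_0Vmem P; first by exists [:: 0%MM]; constructor.
pose F := [arg min_(F < F1 in P) #|F|]; 
have [FP Fmin] : F \in P /\ forall G, G \in P -> (#|F| <= #|G|)%N.
  by rewrite /F; case: arg_minnP.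
have ltD : (#|P :\ F| < n)%N by move: ltP; rewrite (cardsD1 F) FP.
have [s1 std1] : exists s, fy_std F0 (P :\ F) s.
  by apply: IHn => // G /setD1P[_]; exact: F0P.
have [s2 std2] : exists s, fy_std F [set G in P | F \proper G] s.
  apply: IHn => [|G /setIdP[]//]; apply: leq_ltn_trans ltD; apply/subset_leq_card.
  apply/subsetP => G /setIdP[GP FG]; rewrite !inE GP andbT.
  by apply: contraTneq FG => ->; rewrite properxx.
by eexists; apply: fy_stdS FP (F0P _ FP) Fmin std1 std2.
Qed.

Lemma xmonE F G : xmon F (enum_rank G) = (F == G).
Proof. by rewrite /xmon mnm1E (inj_eq enum_rank_inj). Qed.

Lemma fy_std_supp F0 P s b G : fy_std F0 P s -> b \in s -> G \notin P ->
  b (enum_rank G) = 0%N.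
Proof.
move=> std; elim: std b G => {F0 P s} [F0 b G|F0 F P s1 s2 FP F0F Fmin _ IH1 _ IH2 b G].
  by rewrite inE => /eqP-> _; rewrite mnm0E.
rewrite mem_cat => /orP[bs1 nGP|/allpairsP[[i b2] /= [_ b2s ->]] nGP].
  by apply: IH1 => //; apply: contra nGP => /setD1P[].
rewrite mnmDE mulmnE xmonE IH2 //; last by apply: contra nGP => /setIdP[].
by rewrite (negbTE (contraNneq _ nGP)) ?mul0n // => <-.
Qed.

Section Independence.

Definition psiC : {rmorphism rat -> {poly B}} :=
  (polyC : {rmorphism B -> {poly B}}) \o (@mpolyC N rat : {rmorphism rat -> B}).

(** Separates the powers of the variable of F. The coefficients stay in the full ring B, so that
    functionals on B can be applied to them. *)
Definition psi F : {rmorphism B -> {poly B}} :=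
  mmap psiC (fun i => if i == enum_rank F then 'X else ('X_i)%:P).

Lemma psiE F p : psi F p = mmap psiC (fun i => if i == enum_rank F then 'X else ('X_i)%:P) p.
Proof. by []. Qed.

Lemma psi_xvar F G : psi F (xvar G) = if F == G then 'X else (xvar G)%:P.
Proof. by rewrite psiE /xvar mmapX mmap1U (inj_eq enum_rank_inj) eq_sym. Qed.

Lemma psiZ F a p : psi F (a *: p) = (a%:MP)%:P * psi F p.
Proof. by rewrite psiE mmapZ. Qed.

Lemma psi_mon F (b : 'X_{1..N}) : b (enum_rank F) = 0%N -> psi F 'X_[b] = ('X_[b])%:P.
Proof.
move=> bF; rewrite psiE mmapX /mmap1 mpolyXE_id rmorph_prod /=.
apply: eq_bigr => i _; case: eqP => [->|_]; last by rewrite rmorphXn.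
by rewrite bF !expr0.
Qed.

Lemma psi_hsum F S : ~~ (S \subset F) -> psi F (hsum k xvar S) = (hsum k xvar S)%:P.
Proof.
move=> SF; rewrite /hsum !rmorph_sum /=; apply: eq_bigr => H /andP[_ SH].
by rewrite psi_xvar; case: eqP SH SF => // <- ->.
Qed.

(** Hence [hsum F ^+ c] is sent to the modulus used in [ext]. *)
Lemma psi_hsumF F P : up_closed k P -> F \in P ->
  psi F (hsum k xvar F) = 'X + (hsum_gt k xvar F)%:P.
Proof.
move=> upP FP; rewrite (hsumE _ upP FP) rmorphD psi_xvar eqxx; congr (_ + _).
rewrite /hsum_gt !rmorph_sum /=; apply: eq_bigr => H /andP[_ FH].
by rewrite psi_xvar; case: eqP FH => // <-; rewrite properxx.
Qed.

Section ExtStep.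
Variables (F0 F : {set T}) (P : {set {set T}}).
Hypotheses (upP : up_closed k P) (FP : F \in P) (F0F : F0 \proper F)
  (Fmin : forall G, G \in P -> (#|F| <= #|G|)%N)
  (F0P : forall G, G \in P -> F0 \proper G)
  (uflat_F0 : uflat k F0).

Let c := (rho k F - rho k F0)%N.

Lemma c_gt0 : (0 < c)%N.
Proof.
rewrite subn_gt0; have F0k := uflat_proper uflat_F0 F0F.
by rewrite (rho_proper F0k) /rho leq_min (proper_card F0F).
Qed.

Variable mu : nat -> B -> rat.
Hypotheses (addmu : forall i, addfun (mu i))
  (rel0mu : fy_rel0 k (kills (mu 0)) xvar F0 (P :\ F))
  (relmu : forall i, (0 < i)%N ->
     fy_rel0 k (kills (mu i)) xvar F [set G in P | F \proper G]).

Definition lift_fun p : rat := ext c (hsum_gt k xvar F) mu (psi F p).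

Lemma lift_add : addfun lift_fun.
Proof. by move=> p q; rewrite /lift_fun rmorphD /= ext_add. Qed.

Lemma lift_scale (scmu : forall i a p, mu i (a *: p) = a * mu i p) a p :
  lift_fun (a *: p) = a * lift_fun p.
Proof.
rewrite /lift_fun psiZ ext_mulC mulr_sumr; apply: eq_bigr => i _.
by rewrite mul_mpolyC scmu.
Qed.

Lemma lift_mon i (b : 'X_{1..N}) : (i < c)%N -> b (enum_rank F) = 0%N ->
  lift_fun 'X_[xmon F *+ i + b] = mu i 'X_[b].
Proof.
move=> ic bF; rewrite /lift_fun mpolyXD -mpolyXn rmorphM rmorphXn.
by rewrite (psi_mon bF) (_ : 'X_[xmon F] = xvar F) // psi_xvar eqxx ext_X.
Qed.

Lemma lift_kills g : kills (ext c (hsum_gt k xvar F) mu) (psi F g) -> kills lift_fun g.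
Proof. by move=> kg q; rewrite /lift_fun rmorphM kg. Qed.

Let idmu i : is_ideal (kills (mu i)) := kills_ideal (addmu i).

(** A relation free of F is tested on every coefficient, so each [mu i], also for positive i, has to
    annihilate the relations of P without F. *)
Let relmu' i : fy_rel0 k (kills (mu i)) xvar F0 (P :\ F).
Proof.
by case: i => [//|i]; apply: (rel0_weaken kT (idmu _) upP FP F0F Fmin F0P uflat_F0 (relmu _)).
Qed.

Let killsX g : (forall i, (0 < i)%N -> kills (mu i) g) ->
  kills (mu 0) (g * hsum_gt k xvar F ^+ c) ->
  kills (ext c (hsum_gt k xvar F) mu) ('X * g%:P).
Proof. by move=> ? ?; apply: ext_killsX => //; exact: c_gt0. Qed.

Let killsC g : (forall i, kills (mu i) g) -> kills (ext c (hsum_gt k xvar F) mu) g%:P.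
Proof. by move=> ?; apply: ext_killsC => //; exact: c_gt0. Qed.

Lemma lift_incomp_F G : incomp F G -> kills lift_fun (xvar F * xvar G).
Proof.
case/andP=> FG GF; apply: lift_kills; rewrite rmorphM !psi_xvar eqxx.
have -> : (F == G) = false by apply: contraNF FG => /eqP->.
have nGQ : G \notin [set G in P | F \proper G] by rewrite inE properE (negbTE FG) andbF.
apply: killsX => [i /relmu[_]|]; first exact.
exact: (rel0_out kT (idmu 0) upP FP F0F Fmin F0P uflat_F0 rel0mu nGQ).
Qed.

(** By minimality of F, [hsum S] is free of [xvar F] for every other S in P. Thus relations without
    [xvar F] are handled coefficientwise, the power of [hsum F] is the modulus, and those with the
    factor [xvar F] fall under [ext_killsX]. *)
Lemma lift_rel0 : fy_rel0 k (kills lift_fun) xvar F0 P.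
Proof.
split; last first.
  move=> G nGP; apply: lift_kills; rewrite psi_xvar.
  have -> : (F == G) = false by apply: contraNF nGP => /eqP<-.
  apply: killsC => i; apply: (proj2 (relmu' i)).
  by apply: contra nGP => /setD1P[].
split.
- move=> G H GP HP inc; have [eG|nG] := eqVneq F G.
    by rewrite -eG in inc *; exact: lift_incomp_F.
  have [eH|nH] := eqVneq F H.
    by rewrite mulrC -eH; apply: lift_incomp_F; rewrite eH /incomp andbC.
  apply: lift_kills; rewrite rmorphM !psi_xvar (negbTE nG) (negbTE nH) -rmorphM.
  by apply: killsC => i; apply (rel0_incomp (idmu i) (relmu' i) inc).
- move=> S SP; have [<-|nS] := eqVneq F S.
    by apply: lift_kills; rewrite rmorphXn /= (psi_hsumF upP FP); apply: ext_killsM.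
  have SF : ~~ (S \subset F).
    by apply: contra nS => SF; rewrite eq_sym eqEcard SF Fmin.
  apply: lift_kills; rewrite rmorphXn /= psi_hsum // -rmorphXn; apply: killsC => i.
  have [[_ h _] _] := relmu' i; apply: h; by rewrite !inE eq_sym nS.
move=> H S HP SP HS.
have SF : ~~ (S \subset F).
  by apply: contraL (proper_card HS) => /subset_leq_card; have := Fmin HP; lia.
have nS : S != F by apply: contraNneq SF => ->.
apply: lift_kills; rewrite rmorphM rmorphXn /= psi_hsum // psi_xvar -rmorphXn.
have [eH|nH] := eqVneq F H.
  rewrite -eH in HS *.
  have SQ : S \in [set G in P | F \proper G] by rewrite inE SP.
  apply: killsX => [i /relmu[[_ h _] _]|]; first exact: h.
  exact (rel0_above kT (idmu 0) upP FP F0F Fmin uflat_F0 rel0mu SQ).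
rewrite -rmorphM; apply: killsC => i.
have [[_ _ h] _] := relmu' i; apply: h => //; rewrite !inE ?nS //.
by rewrite eq_sym nH.
Qed.

End ExtStep.

Definition linfun (lam : B -> rat) :=
  addfun lam /\ forall a p, lam (a *: p) = a * lam p.

Lemma fy_rel0_zero F0 P : fy_rel0 k (kills (fun=> 0 : rat)) xvar F0 P.
Proof. by do !split. Qed.

Lemma linfun0 : linfun (fun=> 0).
Proof. by split=> [p q|a p]; rewrite ?addr0 ?mulr0. Qed.

Lemma fy_std_dual F0 P s : fy_std F0 P s -> up_closed k P ->
    (forall G, G \in P -> F0 \proper G) -> uflat k F0 ->
  forall b, b \in s -> exists2 lam, linfun lam & fy_rel0 k (kills lam) xvar F0 P /\
    forall b', b' \in s -> lam 'X_[b'] = (b' == b)%:R.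
Proof.
elim=> {F0 P s} [F0 _ _ _ b|F0 F P s1 s2 FP F0F Fmin std1 IH1 std2 IH2 upP F0P fF0 b].
  (* With P empty every variable has to be annihilated; the constant coefficient does so. *)
  rewrite inE => /eqP->; exists (mcoeff 0).
    by split=> [p q|a p]; rewrite ?mcoeffD ?mcoeffZ.
  split=> [|b' _]; last by rewrite mcoeffX.
  split; first by split=> [G H|S|H S]; rewrite inE.
  move=> G _ q; rewrite rmorphM /= mcoeffX (_ : _ == _ = false) ?mul0r //.
  by apply/eqP => /mnmP/(_ (enum_rank G)); rewrite mnm1E eqxx mnm0E.
pose c := (rho k F - rho k F0)%N; pose Q := [set G in P | F \proper G].
have fF : uflat k F by apply: (proj1 upP).
have upD := up_closedD1 upP Fmin; have upQ := up_closed_above F upP.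
have F0D G : G \in P :\ F -> F0 \proper G by case/setD1P=> _; exact: F0P.
have FQ G : G \in Q -> F \proper G by case/setIdP.
have s1F b1 : b1 \in s1 -> b1 (enum_rank F) = 0%N.
  by move=> b1s; rewrite (fy_std_supp std1 b1s) // setD11.
have s2F b2 : b2 \in s2 -> b2 (enum_rank F) = 0%N.
  by move=> b2s; rewrite (fy_std_supp std2 b2s) // inE properxx andbF.
have c0 := c_gt0 F0F fF0.
have sdec b' : b' \in s1 ++ [seq (xmon F *+ i + b)%MM | i <- iota 1 c.-1, b <- s2] ->
    exists i b'', [/\ b' = (xmon F *+ i + b'')%MM, (i < c)%N, b'' (enum_rank F) = 0%N
      & b'' \in if i == 0%N then s1 else s2].
  rewrite mem_cat => /orP[b1|/allpairsP[[i b2] /= [+ b2s ->]]].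
    by exists 0%N, b'; rewrite mulm0n add0m s1F.
  rewrite mem_iota => ic; exists i, b2; rewrite s2F // gtn_eqF; last by lia.
  by split=> //; rewrite /c in c0 ic *; lia.
case/sdec=> i [b0 [-> ic b0F b0s]].
have [lam [addl scl] [rell laml]] : exists2 lam, linfun lam &
    (if i == 0%N then fy_rel0 k (kills lam) xvar F0 (P :\ F)
     else fy_rel0 k (kills lam) xvar F Q) /\
    forall b', b' \in (if i == 0%N then s1 else s2) -> lam 'X_[b'] = (b' == b0)%:R.
  by move: b0s; case: (i == 0%N) => b0s; [exact: IH1 | exact: IH2].
(* Reading only the coefficient of [xvar F ^+ i], by the functional dual to the rest of the
   monomial, separates standard monomials with different exponents at F. *)
pose mu j := if j == i then lam else fun=> 0.
have linmu j : linfun (mu j) by rewrite /mu; case: eqP => // _; exact: linfun0.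
have addmu j : addfun (mu j) by case: (linmu j).
have mu0 : fy_rel0 k (kills (mu 0)) xvar F0 (P :\ F).
  rewrite /mu eq_sym; move: rell; case: eqP => // _ _; exact: fy_rel0_zero.
have muS j : (0 < j)%N -> fy_rel0 k (kills (mu j)) xvar F Q.
  rewrite /mu => j0; case: eqP => [ji|_]; last exact: fy_rel0_zero.
  by move: rell; rewrite -ji gtn_eqF.
exists (lift_fun F0 F mu).
  split; first exact: lift_add.
  by apply: lift_scale => j; case: (linmu j).
split; first exact: lift_rel0.
move=> b' /sdec[i' [b1 [-> ic' b1F b1s]]].
rewrite lift_mon // /mu; have [ei|ni] := eqVneq i' i.
  rewrite -ei in laml *; rewrite laml //; congr (nat_of_bool _)%:R.
  by rewrite (inj_eq (@addmI _ _)).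
case: eqP => // /mnmP/(_ (enum_rank F)).
rewrite !mnmDE !mulmnE xmonE eqxx !mul1n b1F b0F !addn0 => ei.
by rewrite ei eqxx in ni.
Qed.

Lemma fy_std_uniq F0 P s : fy_std F0 P s -> uniq s.
Proof.
elim=> {F0 P s} // F0 F P s1 s2 FP F0F Fmin std1 u1 std2 u2.
have s1F b1 : b1 \in s1 -> b1 (enum_rank F) = 0%N.
  by move=> b1s; rewrite (fy_std_supp std1 b1s) // setD11.
have s2F b2 : b2 \in s2 -> b2 (enum_rank F) = 0%N.
  by move=> b2s; rewrite (fy_std_supp std2 b2s) // inE properxx andbF.
have coefF i b2 : b2 \in s2 -> (xmon F *+ i + b2)%MM (enum_rank F) = i.
  by move=> b2s; rewrite mnmDE mulmnE xmonE eqxx mul1n s2F // addn0.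
rewrite cat_uniq u1 /=; apply/andP; split.
  apply/hasPn => b /allpairsP[[i b2] /= [+ b2s ->]]; rewrite mem_iota => ic.
  apply/negP => /s1F; rewrite coefF // => i0; lia.
apply: allpairs_uniq; rewrite ?iota_uniq //.
move=> [i b] [i' b'] /allpairsP[[? ?] /= [_ bs [-> ->]]].
move=> /allpairsP[[? ?] /= [_ bs' [-> ->]]] /= e.
have ei : _ = _ := congr1 (fun m : 'X_{1..N} => m (enum_rank F)) e.
rewrite /= !coefF // in ei; rewrite ei in e *.
by rewrite (addmI e).
Qed.

End Independence.
End Standard.

(** * Spanning by the standard monomials *)

Section Spanning.
Variables (T : finType) (k m : nat).
Hypothesis kT : (k <= #|T|)%N.
Implicit Types (F G H S : {set T}) (P : {set {set T}}).

Notation N := #|{set T}|.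
Notation R := {mpoly rat[m]}.

Variable xi : {set T} -> R.

Definition mev (b : 'X_{1..N}) : R := mmap1 (fun i => xi (enum_val i)) b.

Lemma mev0 : mev 0%MM = 1. Proof. exact: mmap11. Qed.

Lemma mevD b1 b2 : mev (b1 + b2)%MM = mev b1 * mev b2.
Proof.
rewrite /mev /mmap1 -big_split /=; apply: eq_bigr => i _.
by rewrite mnmDE exprD.
Qed.

Lemma mev_xmon F i : mev (xmon F *+ i)%MM = xi F ^+ i.
Proof.
elim: i => [|i IHi]; first by rewrite mulm0n mev0.
by rewrite mulmS mevD IHi exprS /mev mmap1U enum_rankK.
Qed.

Inductive gen P : R -> Prop :=
| gen_const a : gen P a%:MP
| gen_var F : F \in P -> gen P (xi F)
| gen_add p q : gen P p -> gen P q -> gen P (p + q)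
| gen_mul p q : gen P p -> gen P q -> gen P (p * q).

Lemma gen0 P : gen P 0. Proof. by rewrite -mpolyC0; exact: gen_const. Qed.
Lemma gen1 P : gen P 1. Proof. by rewrite -mpolyC1; exact: gen_const. Qed.

Lemma gen_sum (J : Type) (r : seq J) (Q : pred J) (f : J -> R) P :
  (forall j, Q j -> gen P (f j)) -> gen P (\sum_(j <- r | Q j) f j).
Proof. by move=> gf; apply: big_ind => //; [exact: gen0 | exact: gen_add]. Qed.

Lemma gen_exp P p e : gen P p -> gen P (p ^+ e).
Proof.
move=> gp; elim: e => [|e IHe]; first by rewrite expr0; exact: gen1.
by rewrite exprS; exact: gen_mul.
Qed.

Inductive spanned (s : seq 'X_{1..N}) (I : R -> Prop) : R -> Prop :=
| sp_ideal p : I p -> spanned s I p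
| sp_mon b : b \in s -> spanned s I (mev b)
| sp_add p q : spanned s I p -> spanned s I q -> spanned s I (p + q)
| sp_scale (a : rat) p : spanned s I p -> spanned s I (a *: p).

Lemma sp_congr s I p q : I (p - q) -> spanned s I q -> spanned s I p.
Proof. by move=> Ipq Iq; rewrite -[p](subrK q); apply: sp_add => //; exact: sp_ideal. Qed.

Lemma sp_sum s I (J : Type) (r : seq J) (Q : pred J) (f : J -> R) : is_ideal I ->
  (forall j, Q j -> spanned s I (f j)) -> spanned s I (\sum_(j <- r | Q j) f j).
Proof.
move=> idI gf; apply: big_ind => //; [by apply: sp_ideal; exact: ideal_mem0 | exact: sp_add].
Qed.

Lemma spanned_coef s I p : is_ideal I -> uniq s -> spanned s I p ->
  exists c : 'X_{1..N} -> rat, I (p - \sum_(b <- s) c b *: mev b).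
Proof.
move=> idI us; elim=> {p} [p Ip|b bs|p q _ [c Ip] _ [c' Iq]|a p _ [c Ip]].
- by exists (fun=> 0); rewrite big1 ?subr0 // => b _; rewrite scale0r.
- exists (fun b' => (b' == b)%:R); rewrite (bigD1_seq b) //= eqxx scale1r.
  rewrite big1 ?addr0 ?subrr; first exact: ideal_mem0.
  by move=> b' /negbTE->; rewrite scale0r.
- exists (fun b => c b + c' b); under eq_bigr do rewrite scalerDl.
  by rewrite big_split /= opprD addrACA; exact: ideal_add.
exists (fun b => a * c b); under eq_bigr do rewrite -scalerA.
by rewrite -scaler_sumr -scalerBr -mul_mpolyC; exact: ideal_mull.
Qed.

Lemma gen_poly F P p : gen P p ->
  exists2 f : {poly R}, (forall i, gen (P :\ F) f`_i) & p = f.[xi F].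
Proof.
elim=> {p} [a|G GP|p q _ [f gf ->] _ [g gg ->]|p q _ [f gf ->] _ [g gg ->]].
- exists (a%:MP)%:P; last by rewrite hornerC.
  by move=> i; rewrite coefC; case: eqP => _; [exact: gen_const | exact: gen0].
- have [->|nGF] := eqVneq G F.
    exists 'X; last by rewrite hornerX.
    by move=> i; rewrite coefX; case: eqP => _; [exact: gen1 | exact: gen0].
  exists (xi G)%:P; last by rewrite hornerC.
  move=> i; rewrite coefC; case: eqP => _; last exact: gen0.
  by apply: gen_var; rewrite !inE nGF.
- by exists (f + g) => [i|]; rewrite ?hornerD // coefD; exact: gen_add.
exists (f * g) => [i|]; rewrite ?hornerM // coefM.
by apply: gen_sum => j _; exact: gen_mul.
Qed.

Lemma gen_reduce P (Q : {set {set T}}) I p : is_ideal I ->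
    (forall G, G \in P -> G \notin Q -> I (xi G)) ->
  gen P p -> exists2 q, gen Q q & I (p - q).
Proof.
move=> idI IP; elim=> {p} [a|G GP|p q _ [p' gp Ip] _ [q' gq Iq]|p q _ [p' gp Ip] _ [q' gq Iq]].
- by exists a%:MP; [exact: gen_const | rewrite subrr; exact: ideal_mem0].
- case GQ: (G \in Q).
    by exists (xi G); [exact: gen_var | rewrite subrr; exact: ideal_mem0].
  by exists 0; [exact: gen0 | rewrite subr0; apply: IP; rewrite ?GQ].
- by exists (p' + q'); [exact: gen_add | rewrite opprD addrACA; exact: ideal_add].
exists (p' * q'); first exact: gen_mul.
rewrite (_ : _ - _ = (p - p') * q + p' * (q - q')); last first.
  by rewrite mulrBl mulrBr addrA subrK.
by apply: (ideal_add idI); [exact: ideal_mulr | exact: ideal_mull].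
Qed.

Lemma fy_std_span F0 P s : fy_std k F0 P s -> up_closed k P ->
    (forall G, G \in P -> F0 \proper G) -> uflat k F0 ->
  forall I, is_ideal I -> fy_rel k I xi F0 P -> forall p, gen P p -> spanned s I p.
Proof.
elim=> {F0 P s} [F0 _ _ _ I idI _ p gp|
  F0 F P s1 s2 FP F0F Fmin std1 IH1 std2 IH2 upP F0P fF0 I idI relI p gp].
  have [a ->] : exists a, p = a%:MP.
    elim: gp => {p} [a|F|p q _ [a ->] _ [b ->]|p q _ [a ->] _ [b ->]].
    - by exists a.
    - by rewrite inE.
    - by exists (a + b); rewrite mpolyCD.
    by exists (a * b); rewrite mpolyCM.
  by rewrite -[a%:MP]mulr1 mul_mpolyC -mev0; apply/sp_scale/sp_mon; rewrite inE.
pose c := (rho k F - rho k F0)%N; pose Q := [set G in P | F \proper G].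
set s := s1 ++ _.
have fF : uflat k F by apply: (proj1 upP).
have upD := up_closedD1 upP Fmin; have upQ := up_closed_above F upP.
have F0D G : G \in P :\ F -> F0 \proper G by case/setD1P=> _; exact: F0P.
have FQ G : G \in Q -> F \proper G by case/setIdP.
have c0 : (0 < c)%N := c_gt0 F0F fF0.
have [rel_inc rel_h rel_xh] := relI.
have relD : fy_rel k I xi F0 (P :\ F).
  split=> [G H|S|H S]; rewrite !inE.
  - by move=> /andP[_ GP] /andP[_ HP]; exact: rel_inc.
  - by move=> /andP[_ SP]; exact: rel_h.
  by move=> /andP[_ HP] /andP[_ SP]; exact: rel_xh.
have idIF := ideal_colon (xi F) idI.
(* In the colon ideal the relations are counted from F, which is what the second induction
   hypothesis requires. *)
have relF : fy_rel k (fun p => I (xi F * p)) xi F Q.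
  split=> [G H|S|H S]; rewrite !inE.
  - by move=> /andP[GP _] /andP[HP _] inc; apply: ideal_mull => //; exact: rel_inc.
  - by move=> /andP[SP FS]; exact: rel_xh.
  by move=> /andP[HP _] /andP[SP _] HS; apply: ideal_mull => //; exact: rel_xh.
have sp_small i q : (i < c)%N -> gen (P :\ F) q -> spanned s I (xi F ^+ i * q).
  case: i => [|i] ic gq.
    rewrite mul1r; elim: (IH1 upD F0D fF0 I idI relD q gq) => {gq}q.
    - exact: sp_ideal.
    - by move=> qs; apply: sp_mon; rewrite mem_cat qs.
    - by move=> q' _ sq _ sq'; exact: sp_add.
    by move=> q' _ sq; exact: sp_scale.
  (* One factor [xi F] kills all variables not above F, since F has minimal cardinality in P. *)
  have [|q' gq' Iq'] := gen_reduce (Q := Q) idIF _ gq.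
    move=> G /setD1P[nGF GP]; rewrite inE GP /= => FG; apply: rel_inc => //.
    rewrite /incomp; apply/andP; split.
      by apply: contra FG => FG; rewrite properEneq eq_sym nGF.
    by apply: contra nGF => GF; rewrite eqEcard GF Fmin.
  apply: (sp_congr (q := xi F ^+ i.+1 * q')).
    by rewrite -mulrBr exprSr -mulrA; exact: ideal_mull.
  elim: (IH2 upQ FQ fF _ idIF relF q' gq') => {gq' Iq'}q'.
  - by move=> Iq'; apply: sp_ideal; rewrite exprSr -mulrA; exact: ideal_mull.
  - move=> q's; rewrite -mev_xmon -mevD; apply: sp_mon; rewrite mem_cat.
    apply/orP; right; apply/allpairsP; exists (i.+1, q'); split=> //=.
    by rewrite mem_iota; rewrite -/c; lia.
  - by move=> q'' _ sq _ sq'; rewrite mulrDr; exact: sp_add.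
  by move=> q'' _ sq; rewrite -scalerAr; exact: sp_scale.
have genh : gen (P :\ F) (hsum_gt k xi F).
  apply: gen_sum => H /andP[fH FH]; apply: gen_var; rewrite !inE.
  by rewrite (proj2 upP _ _ FP fH (proper_sub FH)) andbT (contraTneq _ FH) // => ->;
     rewrite properxx.
(* For exponents from c on, the power [hsum F ^+ c] in I is monic in [xi F] and rewrites [xi F ^+ c]
   into lower powers with coefficients free of F. *)
have sp_all i q : gen (P :\ F) q -> spanned s I (xi F ^+ i * q).
  have [n] := ubnP i; elim: n => // n IHn in i q * => ltin gq.
  have [ic|ci] := ltnP i c; first exact: sp_small.
  rewrite -(subnK ci) exprD.
  have -> : xi F ^+ c = hsum k xi F ^+ c -
      \sum_(l < c) (hsum_gt k xi F ^+ (c - l) * xi F ^+ l) *+ 'C(c, l).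
    rewrite (hsumE _ upP FP) [xi F + _]addrC exprDn big_ord_recr /= subnn mul1r binn mulr1n.
    by rewrite addrAC subrr add0r.
  rewrite mulrBr mulrBl; apply: sp_add.
    apply: sp_ideal; apply: ideal_mulr => //; apply: ideal_mull => //; exact: rel_h.
  rewrite -scaleN1r; apply: sp_scale; rewrite mulr_sumr mulr_suml.
  apply: sp_sum => // l _; rewrite mulrnAr mulrnAl -scaler_nat; apply: sp_scale.
  have -> (x y z w : R) : x * (y * z) * w = x * z * (y * w) by ring.
  rewrite -exprD.
  apply: IHn; last by apply: gen_mul => //; exact: gen_exp.
  by have := ltn_ord l; lia.
have [f gf ->] := gen_poly F gp.
rewrite horner_coef; apply: sp_sum => // i _; rewrite mulrC; exact: sp_all.
Qed.

End Spanning.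

(** * Excedances and descents *)

Lemma lift_perm_surj n (i j : 'I_n.+1) (s : 'S_n.+1) :
  s i = j -> exists t : 'S_n, s = lift_perm i j t.
Proof.
move=> sij.
have neq k : j != s (lift i k) by rewrite -sij (inj_eq perm_inj) neq_lift.
pose f k := odflt k (unlift j (s (lift i k))).
have fE k : lift j (f k) = s (lift i k).
  by rewrite /f; case/unlift_some: (neq k) => l -> ->.
have f_inj : injective f.
  by move=> k l /(congr1 (lift j)); rewrite !fE => /perm_inj/lift_inj.
exists (perm f_inj); apply/permP => k; case: (unliftP i k) => [l|] ->.
  by rewrite lift_perm_lift permE fE.
by rewrite lift_perm_id.
Qed.

Lemma big_lift_perm (V : nmodType) n (i j : 'I_n.+1) (f : 'S_n.+1 -> V) :
  \sum_(s : 'S_n.+1 | s i == j) f s = \sum_t f (lift_perm i j t).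
Proof.
transitivity (\sum_(s in [set lift_perm i j t | t in 'S_n]) f s).
  apply: eq_bigl => s; apply/eqP/imsetP => [/lift_perm_surj[t ->]|[t _ ->]].
    by exists t.
  exact: lift_perm_id.
rewrite big_imset /=; first by apply: eq_bigl => t; rewrite inE.
move=> s t _ _ /permP e; apply/permP => k; apply: (@lift_inj _ j).
by rewrite -!(lift_perm_lift i) e.
Qed.

Definition nfix n (s : 'S_n) : nat := #|[set i | s i == i]|.

Definition excfix n f : {poly rat} := \sum_(s : 'S_n | nfix s == f) 'X^(exc s).

Lemma card_ord_lift n (P : pred 'I_n.+1) i :
  #|[set j | P j]| = (P i + #|[set k | P (lift i k)]|)%N.
Proof.
rewrite -!sum1dep_card big_mkcond (bigD1_ord i) //=; congr (_ + _)%N.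
by rewrite [RHS]big_mkcond.
Qed.

Lemma nfix_lift n (i : 'I_n.+1) (s : 'S_n) : nfix (lift_perm i i s) = (nfix s).+1.
Proof.
rewrite /nfix (card_ord_lift _ i) lift_perm_id eqxx add1n; congr _.+1.
by apply: eq_card => k; rewrite !inE lift_perm_lift (inj_eq lift_inj).
Qed.

Lemma exc_lift n (i : 'I_n.+1) (s : 'S_n) : exc (lift_perm i i s) = exc s.
Proof.
rewrite /exc (card_ord_lift _ i) lift_perm_id ltnn add0n.
apply: eq_card => k; rewrite !inE lift_perm_lift /=.
by rewrite ltnNge leq_bump2 -ltnNge.
Qed.

(* Double counting of the permutations with a marked fixed point. *)
Lemma excfixS n f : excfix n.+1 f.+1 *+ f.+1 = excfix n f *+ n.+1.
Proof.
rewrite /excfix -sumrMnl.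
transitivity (\sum_(i : 'I_n.+1) \sum_(s : 'S_n.+1 | s i == i)
   (if nfix s == f.+1 then 'X^(exc s) else 0 : {poly rat})).
  rewrite [RHS](exchange_big_dep xpredT) //= big_mkcond; apply: eq_bigr => s _.
  rewrite sumr_const; case: eqP => [<-|_]; last by rewrite mul0rn.
  by congr (_ *+ _); apply: eq_card => i; rewrite !inE.
rewrite (eq_bigr (fun=> excfix n f)) ?sumr_const ?card_ord // => i _.
rewrite big_lift_perm /excfix [RHS]big_mkcond; apply: eq_bigr => s _.
by rewrite nfix_lift exc_lift eqSS.
Qed.

Lemma excfix_bin n f : (f <= n)%N -> excfix n f = excfix (n - f) 0 *+ 'C(n, f).
Proof.
elim: f n => [|f IHf] n le; first by rewrite subn0 bin0.
case: n le => // n le.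
have inj : injective (fun p : {poly rat} => p *+ f.+1).
  move=> p q /eqP; rewrite -subr_eq0 -mulrnBl -scaler_nat scaler_eq0.
  by rewrite Num.Theory.pnatr_eq0 /= subr_eq0 => /eqP.
apply: inj; rewrite excfixS subSS IHf // -!mulrnA; congr (_ *+ _).
by rewrite mulnC mul_bin_diag mulnC.
Qed.

Lemma derangementE n : derangement n = excfix n 0.
Proof.
apply: eq_bigl => s; rewrite /nfix cards_eq0; apply/forallP/eqP => [h|/setP e i].
  by apply/setP => i; rewrite !inE; apply/negbTE.
by have := e i; rewrite !inE => ->.
Qed.

Definition excpoly n : {poly rat} := \sum_(s : 'S_n) 'X^(exc s).

(** Here j is the number of points moved: away from its n - j fixed points a permutation is a
    derangement. The weight 1 gives all excedances, the weight X^f gives the weak ones. *)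
Lemma excfix_sum n (w : nat -> {poly rat}) :
  \sum_(s : 'S_n) w (nfix s) * 'X^(exc s) =
  \sum_(j < n.+1) (derangement j * w (n - j)%N) *+ 'C(n, j).
Proof.
rewrite (partition_big (fun s => inord (nfix s) : 'I_n.+1) xpredT) //=.
rewrite (reindex_inj rev_ord_inj) /=; apply: eq_bigr => j _.
have jn : (j <= n)%N by rewrite -ltnS.
rewrite derangementE.
have nf (s : 'S_n) : (nfix s < n.+1)%N.
  by have := max_card (mem [set i | s i == i]); rewrite card_ord.
rewrite (eq_bigl (fun s => nfix s == n - j)%N); last first.
  by move=> s; rewrite -val_eqE /= inordK ?subSS.
rewrite (eq_bigr (fun s => w (n - j)%N * 'X^(exc s))) => [|s /eqP-> //].
rewrite -big_distrr /=.
have := excfix_bin (leq_subr j n); rewrite subKn // bin_sub // => e.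
by rewrite -mulrnAl -e mulrC.
Qed.

Lemma excpolyE n : excpoly n = \sum_(j < n.+1) derangement j *+ 'C(n, j).
Proof.
have := excfix_sum n (fun=> 1); under eq_bigr do rewrite mul1r.
by move=> e; rewrite /excpoly e; apply: eq_bigr => j _; rewrite mulr1.
Qed.

(* Composing with the cyclic shift turns weak excedances into excedances,
   except at the preimage of the maximum. *)
Lemma wexc_sum n : \sum_(j < n.+2) (derangement j * 'X^(n.+1 - j)) *+ 'C(n.+1, j)
  = 'X * excpoly n.+1.
Proof.
rewrite -(excfix_sum _ (fun f => 'X^f)) /excpoly big_distrr /=.
pose c : 'S_n.+1 := perm (@ordS_inj n.+1).
rewrite [RHS](reindex_inj (mulIg c)); apply: eq_bigr => s _ /=.
rewrite -exprD -exprS; congr ('X^_); pose i0 := (s^-1)%g ord_max.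
have -> : (nfix s + exc s)%N = #|[set i : 'I_n.+1 | (i <= s i)%N]|.
  rewrite /nfix /exc -cardsUI [X in (_ + #|pred_of_set X|)%N](_ : _ = set0).
    rewrite cards0 addn0; apply: eq_card => i; rewrite !inE.
    by rewrite [RHS]leq_eqVlt eq_sym -val_eqE.
  by apply/setP => i; rewrite !inE; case: eqP => // ->; rewrite ltnn.
rewrite (cardsD1 i0) inE permKV leq_ord add1n; congr _.+1.
apply: eq_card => i; rewrite !inE permM permE /=.
have [->|ni] := eqVneq i i0; first by rewrite permKV /= modnn.
rewrite modn_small ?ltnS // ltn_neqAle -ltnS ltn_ord andbT.
by apply: contra ni => /eqP e; rewrite -(inj_eq (@perm_inj _ s)) permKV; apply/eqP/val_inj.
Qed.

Fixpoint sdes (w : seq nat) : nat :=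
  (* The default x of [head] prevents a descent at the last letter. *)
  if w is x :: w' then ((head x w' < x) + sdes w')%N else 0%N.

(** Of the n + 1 ways to insert a new maximum, d + 1 keep the statistic and n - d raise it by one.
    Descents and excedances share this count, which is why they are equidistributed. *)
Definition insert_step n d : {poly rat} := 'X^d *+ d.+1 + 'X^(d.+1) *+ (n - d).

Lemma sdes_size w : (sdes w <= (size w).-1)%N.
Proof.
elim: w => // x [|y w] /=; first by rewrite ltnn.
by case: (y < x)%N; lia.
Qed.

(* Inserting a new maximum creates a descent unless it lands at the end
   or inside a descent. *)
Lemma sdes_insert N (w : seq nat) : all (fun x => x < N)%N w ->
  \sum_(i < (size w).+1) 'X^(sdes (take i w ++ N :: drop i w))
  = insert_step (size w) (sdes w).
Proof.
elim: w => [_|x [|y w] IHw /= /andP[xN wN]].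
- by rewrite big_ord_recl big_ord0 /= ltnn /insert_step subnn addr0.
- rewrite !big_ord_recl big_ord0 /= xN ltnn ltnNge (ltnW xN) /insert_step /=.
  by rewrite ltnn !addn0 subn0 !mulr1n addr0 addrC.
have yN : (y < N)%N by case/andP: wN.
have Nx : (N < x)%N = false by rewrite ltnNge (ltnW xN).
rewrite big_ord_recl /= big_ord_recl /=.
have := IHw wN; rewrite big_ord_recl /= yN xN Nx !add0n.
set d := ((head y w < y) + sdes w)%N => IH.
have dle : (d <= size w)%N by have := sdes_size (y :: w).
under eq_bigr do rewrite exprD.
rewrite -big_distrr /=; move: IH; set S := \sum_(i < _) _ => IH.
(* S collects the insertions behind y; the one in front of y has 1 + d descents and is
   subtracted. *)
have -> : S = insert_step (size w).+1 d - 'X^(1 + d) by rewrite -IH addrAC subrr add0r.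
rewrite /insert_step; case: (y < x)%N => /=; rewrite ?add1n ?add0n.
  by rewrite subSS subSn // !mulrSr !exprS; ring.
rewrite expr0 mul1r subSn ?(leq_trans dle) // [in RHS]subSn ?subSn ?(leq_trans dle) //.
by rewrite !mulrSr !exprS; ring.
Qed.

Lemma sdesE w :
  sdes w = (\sum_(p < (size w).-1) (nth 0 w p.+1 < nth 0 w p))%N.
Proof.
elim: w => [|x [|y w] IHw]; rewrite ?big_ord0 //=; first by rewrite ltnn.
by rewrite big_ord_recl; congr (_ + _)%N; exact: IHw.
Qed.

Definition word n (s : 'S_n) : seq nat := [seq val (s i) | i <- enum 'I_n].

Lemma size_word n (s : 'S_n) : size (word s) = n.
Proof. by rewrite size_map size_enum_ord. Qed.

Lemma nth_word n (s : 'S_n) (i : 'I_n) : nth 0 (word s) i = s i.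
Proof. by rewrite (nth_map i) ?size_enum_ord // nth_ord_enum. Qed.

Lemma des_word n (s : 'S_n) : des s = sdes (word s).
Proof.
rewrite sdesE size_word; case: n s => [|n] s.
  by rewrite big_ord0; apply: eq_card0 => -[[]].
pose f (p : 'I_n) : 'I_n.+1 * 'I_n.+1 := (widen_ord (leqnSn n) p, lift ord0 p).
have f_inj : injective f.
  by move=> p q /(congr1 (fun x => val x.1)) /= e; apply: val_inj.
transitivity #|f @: [set p | (s (f p).2 < s (f p).1)%N]|.
  apply: eq_card => -[i j]; rewrite !inE /=; apply/andP/imsetP => /=.
    case=> /eqP ij lt; have jn : (i < n)%N by rewrite -ltnS -ij.
    have ei : widen_ord (leqnSn n) (Ordinal jn) = i by exact: val_inj.
    have ej : lift ord0 (Ordinal jn) = j by exact: val_inj.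
    by exists (Ordinal jn); rewrite ?inE /f /= ?ei ?ej.
  by case=> p; rewrite inE /= => lt [-> ->].
rewrite card_imset // -sum1dep_card big_mkcond /=; apply: eq_bigr => p _.
rewrite -(nth_word s (lift ord0 p)) -(nth_word s (widen_ord _ p)) /=.
by case: ltnP.
Qed.

Lemma word_lift n (s : 'S_n) (i : 'I_n.+1) :
  word (lift_perm i ord_max s) = take i (word s) ++ n :: drop i (word s).
Proof.
have szt : size (take i (word s)) = i.
  by rewrite size_takel // size_word -ltnS.
apply: (@eq_from_nth _ 0) => [|p].
  by rewrite size_cat /= addnS -size_cat cat_take_drop !size_word.
rewrite size_word => pn; rewrite (nth_word _ (Ordinal pn)) nth_cat szt /=.
case: (unliftP i (Ordinal pn)) => [k|] /= e; rewrite e.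
  have {}e : p = bump i k := congr1 val e.
  rewrite lift_perm_lift /= /bump leqNgt ltn_ord add0n e /bump -nth_word.
  case: (leqP i k) => ik; last by rewrite add0n ik nth_take.
  by rewrite add1n ltnNge (leqW ik) /= subSn //= nth_drop subnKC.
have {}e : p = i := congr1 val e.
by rewrite lift_perm_id e ltnn subnn.
Qed.

Lemma eulerianS n : eulerian n.+1 = \sum_(s : 'S_n) insert_step n (des s).
Proof.
rewrite /eulerian (partition_big (fun s : 'S_n.+1 => (s^-1)%g ord_max) xpredT) //=.
under eq_bigr => i _ do under eq_bigl => s do
  rewrite (can2_eq (permKV s) (permK s)) eq_sym.
under eq_bigr => i _ do rewrite big_lift_perm.
rewrite exchange_big /=; apply: eq_bigr => s _.
have wn : all (fun x => x < n)%N (word s) by apply/allP => x /mapP[i _ ->] /=.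
have := sdes_insert wn; rewrite size_word -des_word => <-.
by apply: eq_bigr => i _; rewrite des_word word_lift.
Qed.

(** The transposition inserts the new maximum into a cycle just after k, as k -> n -> s k. This adds
    an excedance at k unless k already was one; the remaining choice of i leaves n fixed. *)
Lemma exc_insert n (s : 'S_n) :
  \sum_(i < n.+1) 'X^(exc (tperm i ord_max * lift_perm ord_max ord_max s)%g) =
  insert_step n (exc s).
Proof.
have lm (l : 'I_n) : lift ord_max l = l :> nat by rewrite /= /bump leqNgt ltn_ord.
rewrite (bigD1_ord ord_max) //= tperm1 mul1g exc_lift.
set A := [set k : 'I_n | (k < s k)%N]; rewrite /exc -/A.
have excE (k : 'I_n) :
    exc (tperm (lift ord_max k) ord_max * lift_perm ord_max ord_max s)%g
    = ((k \notin A) + #|A|)%N.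
  rewrite -cardsU1 /exc (card_ord_lift _ ord_max) permM tpermR lift_perm_lift.
  rewrite lm ltnNge ltnW ?ltn_ord // add0n; apply: eq_card => l; rewrite !inE permM.
  have [->|nlk] := eqVneq l k; first by rewrite tpermL lift_perm_id lm ltn_ord.
  by rewrite tpermD ?lift_perm_lift ?lm ?neq_lift // (inj_eq lift_inj) eq_sym.
under eq_bigr => k _ do rewrite -/(exc _) excE.
rewrite (bigID (fun k => k \in A)) /=.
rewrite (eq_bigr (fun=> 'X^#|A|)) => [|k ->]; last by rewrite add0n.
rewrite [X in _ + (_ + X)](eq_bigr (fun=> 'X^(#|A|.+1))) => [|k ->]; last by rewrite add1n.
rewrite !sumr_const /insert_step mulrS addrA; congr (_ + _ *+ _).
have <- : #|~: A| = (n - #|A|)%N by rewrite cardsCs setCK card_ord.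
by apply: eq_card => k; rewrite in_setC.
Qed.

Lemma excpolyS n : excpoly n.+1 = \sum_(s : 'S_n) insert_step n (exc s).
Proof.
rewrite /excpoly (partition_big (fun s : 'S_n.+1 => (s^-1)%g ord_max) xpredT) //=.
under [RHS]eq_bigr do rewrite -exc_insert.
rewrite [RHS]exchange_big /=; apply: eq_bigr => i _.
rewrite (reindex_inj (mulgI (tperm i ord_max))) /=.
rewrite -(big_lift_perm _ _ (fun s => 'X^(exc (tperm i ord_max * s)%g))).
apply: eq_bigl => s; rewrite (can2_eq (permKV _) (permK _)) permM tpermL.
by rewrite eq_sym.
Qed.

(** In this form the step is linear in X^d, so a sum over permutations depends only on the
    generating polynomial p: it is the Eulerian recursion (1 + n x) p + x (1 - x) p'. *)
Lemma insert_step_linear n d : (d <= n)%N ->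
  insert_step n d = 'X^d + 'X * ('X^d)^`() + 'X^(d.+1) *+ n - 'X ^+ 2 * ('X^d)^`().
Proof.
move=> dn; rewrite /insert_step mulrnBr // derivXn.
have -> : 'X * ('X^(d.-1) *+ d) = 'X^d *+ d :> {poly rat}.
  by case: d {dn} => [|d]; rewrite ?mulr0n ?mulr0 // mulrnAr -exprS.
have -> : 'X ^+ 2 * ('X^(d.-1) *+ d) = 'X^(d.+1) *+ d :> {poly rat}.
  by case: d {dn} => [|d]; rewrite ?mulr0n ?mulr0 // mulrnAr -exprD.
by rewrite mulrS addrA.
Qed.

Lemma eulerianE n : eulerian n = excpoly n.
Proof.
elim: n => [|n IHn].
  by apply: eq_bigr => s _; rewrite /des /exc !eq_card0 // => [[]|[[]]] [].
pose op (p : {poly rat}) := p + 'X * p^`() + ('X * p) *+ n - 'X ^+ 2 * p^`().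
have opE (J : finType) (d : J -> nat) : (forall j, d j <= n)%N ->
    \sum_j insert_step n (d j) = op (\sum_j 'X^(d j)).
  move=> dn; rewrite /op linear_sum !big_distrr /= -sumrMnl -!big_split /=.
  rewrite -sumrB; apply: eq_bigr => j _.
  by rewrite insert_step_linear // exprS.
rewrite eulerianS excpolyS !opE -?/(eulerian n) -?/(excpoly n) ?IHn // => s.
  by rewrite /exc (leq_trans (max_card _)) ?card_ord.
rewrite des_word (leq_trans (sdes_size _)) // size_word; exact: leq_pred.
Qed.

(** * Recursions for the two polynomials *)

Lemma geomS m : geom m.+1 = 1 + 'X * geom m.
Proof.
rewrite /geom big_ord_recl expr0 big_distrr /=; congr (_ + _).
by apply: eq_bigr => i _; rewrite -exprS.
Qed.

Lemma geom0 : geom 0 = 0. Proof. exact: big_ord0. Qed.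

(** After multiplication by x - 1 this is the difference of [wexc_sum] and [excpolyE], whose terms
    at j = t + 1 cancel. *)
Lemma eulerian_rec t :
  eulerian t.+1 = \sum_(j < t.+1) (derangement j * geom (t.+1 - j)) *+ 'C(t.+1, j).
Proof.
have X1 : 'X - 1 != 0 :> {poly rat} by rewrite polyXsubC_eq0.
apply: (mulfI X1); rewrite [RHS]big_distrr /= mulrBl mul1r.
rewrite eulerianE -wexc_sum {1}excpolyE -sumrB big_ord_recr /=.
rewrite subnn mulr1 subrr addr0; apply: eq_bigr => j _.
rewrite -mulrnBl mulrnAr mulrCA; congr (_ *+ _).
by rewrite /geom -subrX1 mulrBr mulr1.
Qed.

Lemma derangement_rec t : derangement t.+1 =
  \sum_(j < t.+1) (derangement j * ('X * geom (t - j))) *+ 'C(t.+1, j).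
Proof.
apply: (addrI (\sum_(j < t.+1) derangement j *+ 'C(t.+1, j))).
rewrite -big_split /=; have := excpolyE t.+1; rewrite big_ord_recr /= binn => <-.
rewrite -eulerianE eulerian_rec; apply: eq_bigr => j _.
have jt : (j <= t)%N by rewrite -ltnS.
by rewrite -mulrnDl subSn // geomS mulrDr mulr1.
Qed.

Lemma derangement0 : derangement 0 = 1.
Proof.
rewrite /derangement (big_pred1 1%g) => [|s]; last first.
  rewrite (_ : s = 1%g); last by apply/permP => -[].
  by rewrite /= eqxx; apply/forallP => -[].
by rewrite /exc eq_card0 // => -[].
Qed.

Lemma eulerian0 : eulerian 0 = 1.
Proof. by rewrite eulerianE excpolyE big_ord_recl big_ord0 derangement0 addr0. Qed.

Lemma big_triangle (V : nmodType) K (f : nat -> nat -> V) :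
  \sum_(t < K) \sum_(j < t.+1) f (t - j)%N j = \sum_(s < K) \sum_(j < K - s) f s j.
Proof.
elim: K => [|K IHK]; first by rewrite !big_ord0.
rewrite big_ord_recr /= {}IHK [RHS]big_ord_recr /= subSnn big_ord1.
rewrite [in RHS](eq_bigr (fun s : 'I_K => \sum_(j < K - s) f s j + f s (K - s)%N)).
  rewrite big_split /= -addrA; congr (_ + _); rewrite (reindex_inj rev_ord_inj) /=.
  rewrite big_ord_recr /= subSS subnn subn0; congr (_ + _); apply: eq_bigr => i _.
  by rewrite subSS subKn // ltnW.
by move=> s _; rewrite subSn ?(ltnW (ltn_ord s)) // big_ord_recr.
Qed.

Lemma bin_trinomial n s j :
  ('C(n, s) * 'C(n - s, j) = 'C(n, s + j) * 'C(s + j, j))%N.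
Proof.
have [le|gt] := leqP (s + j) n; last first.
  rewrite ['C(n, s + j)]bin_small //; have [sn|] := leqP s n.
    by rewrite ['C(n - s, j)]bin_small ?muln0 //; lia.
  by move=> ns; rewrite bin_small.
apply/eqP; rewrite -(eqn_pmul2r (fact_gt0 s)) -(eqn_pmul2r (fact_gt0 j)).
rewrite -(eqn_pmul2r (fact_gt0 (n - (s + j)))); apply/eqP.
have e1 : ('C(n, s) * (s`! * (n - s)`!) = n`!)%N by apply: bin_fact; lia.
have e2 : ('C(n - s, j) * (j`! * (n - s - j)`!) = (n - s)`!)%N by apply: bin_fact; lia.
have e3 : ('C(n, s + j) * ((s + j)`! * (n - (s + j))`!) = n`!)%N by apply: bin_fact.
have e4 : ('C(s + j, j) * (j`! * (s + j - j)`!) = (s + j)`!)%N by apply: bin_fact; lia.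
rewrite addnK in e4; rewrite subnDA in e3 *.
transitivity n`!; first by rewrite -e1 -e2; ring.
by rewrite -e3 -e4; ring.
Qed.

Definition chow_poly n k : {poly rat} :=
  \sum_(j < k) 'C(n, j)%:R *: (derangement j * geom (k - 1 - j).+1).

Definition aug_poly n k : {poly rat} :=
  1 + 'X * \sum_(j < k) 'C(n, j)%:R *: (eulerian j * geom (k - 1 - j).+1).

Lemma chow_polyE n k : chow_poly n k =
  \sum_(j < k) (derangement j * geom (k - j)) *+ 'C(n, j).
Proof.
apply: eq_bigr => j _; rewrite scaler_nat; congr (_ * geom _ *+ _).
by have := ltn_ord j; lia.
Qed.

(** In terms of monomials, s + 1 is the size of the smallest flat and ['X * geom s] lists its
    exponents; [geom k.+1] accounts for the monomial 1 and the powers of the ground set. It follows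
    by expanding each derangement polynomial of positive index and exchanging the sums. *)
Lemma chow_poly_rec n k : chow_poly n k.+1 = geom k.+1 +
  \sum_(s < k) ('X * geom s * chow_poly (n - s.+1) (k - s)) *+ 'C(n, s.+1).
Proof.
rewrite chow_polyE big_ord_recl derangement0 mul1r bin0; congr (_ + _).
pose f s j := 'X * geom s * (derangement j * geom (k - s - j)) *+
  ('C(n, s.+1 + j) * 'C(s.+1 + j, j)).
transitivity (\sum_(s < k) \sum_(j < k - s) f s j); last first.
  apply: eq_bigr => s _; rewrite chow_polyE big_distrr /= -sumrMnl.
  apply: eq_bigr => j _; rewrite mulrnAr -mulrnA /f -bin_trinomial mulnC.
  by congr (_ *+ _).
rewrite -big_triangle; apply: eq_bigr => t _.
rewrite lift0 derangement_rec subSS mulr_suml -sumrMnl.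
apply: eq_bigr => j _; have jt : (j <= t)%N by rewrite -ltnS.
rewrite /f addSn subnK // -subnDA subnK // mulrnAl -mulrnA mulnC.
by congr (_ *+ _); ring.
Qed.

(** As before, but every flat contains an extra point: s counts the other points of the smallest
    flat, whose rank is s + 1. *)
Lemma aug_poly_rec n k : aug_poly n k = geom k.+1 +
  \sum_(s < k) ('X * geom s * chow_poly (n - s) (k - s)) *+ 'C(n, s).
Proof.
case: k => [|k]; first by rewrite /aug_poly !big_ord0 mulr0 geomS geom0 mulr0 !addr0.
pose f s j := 'X * geom s * (derangement j * geom (k.+1 - s - j)) *+
  ('C(n, s + j) * 'C(s + j, j)).
transitivity (geom k.+2 + \sum_(s < k.+1) \sum_(j < k.+1 - s) f s j); last first.
  congr (_ + _); apply: eq_bigr => s _; rewrite chow_polyE big_distrr /= -sumrMnl.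
  apply: eq_bigr => j _; rewrite mulrnAr -mulrnA /f -bin_trinomial mulnC.
  by congr (_ *+ _).
(* The term t = 0 of the triangle vanishes with [geom 0]; the term j = 0 on the left supplies the
   tail of [geom k.+2]. *)
rewrite -big_triangle big_ord_recl big_ord_recl big_ord0 addr0 {1}/f geom0.
rewrite mulr0 mul0r mul0rn add0r [in RHS]geomS -addrA; congr (_ + _).
rewrite big_ord_recl mulrDr bin0 scale1r eulerian0 mul1r subn0 subn1 /=.
congr (_ + _); rewrite mulr_sumr; apply: eq_bigr => t _.
rewrite /bump leq0n add1n eulerian_rec [RHS]big_ord_recr /= {2}/f subnn geom0.
rewrite mulr0 mul0r mul0rn addr0 scaler_nat mulr_suml -sumrMnl mulr_sumr.
apply: eq_bigr => j _; have jt : (j <= t)%N by rewrite -ltnS.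
rewrite /f subnK ?(leqW jt) // -subnDA subnK ?(leqW jt) //.
have -> : (k - t.+1).+1 = (k.+1 - t.+1)%N by have := ltn_ord t; lia.
rewrite mulrnAl -mulrnA mulrnAr mulnC.
by congr (_ *+ _); ring.
Qed.

(** * Counting standard monomials *)

Section Counting.
Variables (T : finType) (k : nat).
Hypothesis kT : (k <= #|T|)%N.
Implicit Types (F G H S : {set T}) (P : {set {set T}}).

Lemma sum_supsets (V : nmodType) F (phi : nat -> V) :
  \sum_(G : {set T} | F \subset G) phi (#|G| - #|F|)%N =
  \sum_(s < (#|T| - #|F|).+1) phi s *+ 'C(#|T| - #|F|, s).
Proof.
have cC : #|~: F| = (#|T| - #|F|)%N by rewrite cardsCs setCK.
rewrite -cC (eq_bigr (fun G => phi #|G :\: F|)); last by move=> G FG; rewrite cardsDS.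
rewrite (reindex_onto (fun X => F :|: X) (fun G => G :\: F)) /=; last first.
  by move=> G FG; rewrite setDE setUIr setUCr setIT; apply/setUidPr.
rewrite (eq_big (fun X : {set T} => X \subset ~: F) (fun X => phi #|X|)).
- rewrite (partition_big (fun X : {set T} => inord #|X| : 'I_#|~: F|.+1) xpredT) //=.
  apply: eq_bigr => s _.
  rewrite (eq_bigl (fun X => X \in [set X : {set T} | X \subset ~: F & #|X| == s])).
    rewrite (eq_bigr (fun=> phi s)); last by move=> X; rewrite inE => /andP[_ /eqP->].
    by rewrite sumr_const cards_draws.
  move=> X; rewrite !inE; case sX: (X \subset _) => //=.
  by rewrite -val_eqE /= inordK // ltnS subset_leq_card.
- move=> X; rewrite subsetUl /= setDUl setDv set0U setDE.
  exact: (sameP eqP setIidPl).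
by move=> X /andP[_ /eqP->].
Qed.

(** Generating polynomial of the standard monomials above F: the flats above a proper flat form the
    lattice of a uniform matroid with both parameters lowered by [#|F|]. *)
Definition fy_weight F : {poly rat} :=
  if F == setT then 1 else chow_poly (#|T| - #|F|) (k - #|F|).

Lemma fy_weight_rec F : uflat k F ->
  fy_weight F = 1 + \sum_(G | uflat k G && (F \proper G))
    'X * geom (rho k G - rho k F).-1 * fy_weight G.
Proof.
have [->|nFT] := eqVneq F setT.
  move=> _; rewrite /fy_weight eqxx big1 ?addr0 // => G /andP[_].
  by rewrite properE subsetT andbF.
case/orP=> [Fk|/eqP eF]; last by rewrite eF eqxx in nFT.
rewrite {1}/fy_weight (negbTE nFT).
have [K kE] : exists K, (k - #|F| = K.+1)%N by exists (k - #|F|).-1; lia.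
rewrite kE chow_poly_rec geomS -addrA; congr (_ + _).
have KT : (K.+1 <= #|T| - #|F|)%N by rewrite -kE leq_sub2r.
rewrite (bigD1 setT) /=; last by rewrite /uflat eqxx orbT properT.
rewrite (rhoT kT) (rho_proper Fk) kE /= {1}/fy_weight eqxx mulr1; congr (_ + _).
(* A proper superset of F other than the ground set is a flat only when it adds at most K points,
   hence the cut-off. *)
pose phi s := if (0 < s <= K)%N then
  'X * geom s.-1 * chow_poly (#|T| - #|F| - s) (K.+1 - s) else 0.
transitivity (\sum_(s < (#|T| - #|F|).+1) phi s *+ 'C(#|T| - #|F|, s)).
  rewrite big_ord_recl {1}/phi /= mul0rn add0r.
  rewrite (big_ord_widen _ (fun s => ('X * geom s *
    chow_poly (#|T| - #|F| - s.+1) (K - s)) *+ 'C(#|T| - #|F|, s.+1)) (ltnW KT)).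
  rewrite big_mkcond; apply: eq_bigr => s _.
  by rewrite /phi /bump leq0n add1n /= subSS; case: ifP; rewrite ?mul0rn.
rewrite -sum_supsets [RHS]big_mkcond [LHS]big_mkcond /=; apply: eq_bigr => G _.
have [FG|FG] := boolP (F \subset G); last first.
  by rewrite properE (negbTE FG) andbF.
have [->|nGT] := eqVneq G setT; first by rewrite andbF /phi cardsT; case: ifP => //; lia.
rewrite andbT /uflat (negbTE nGT) orbF properEcard FG /= /phi.
rewrite /fy_weight (negbTE nGT).
have := subset_leq_card FG => cFG.
have -> : (0 < #|G| - #|F| <= K)%N = (#|G| < k)%N && (#|F| < #|G|)%N by lia.
case: ifP => // /andP[Gk _]; rewrite (rho_proper Gk).
by congr (_ * chow_poly _ _); lia.
Qed.

Lemma fy_std_count F0 P s : fy_std k F0 P s -> up_closed k P ->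
    (forall G, G \in P -> F0 \proper G) -> uflat k F0 ->
  \sum_(b <- s) 'X^(mdeg b) = 1 + \sum_(F in P)
    'X * geom (rho k F - rho k F0).-1 * fy_weight F.
Proof.
elim=> {F0 P s} [F0 _ _ _|F0 F P s1 s2 FP F0F Fmin std1 IH1 std2 IH2 upP F0P fF0].
  by rewrite big_seq1 mdeg0 expr0 big_set0 addr0.
have fF : uflat k F by apply: (proj1 upP).
have upD := up_closedD1 upP Fmin; have upQ := up_closed_above F upP.
rewrite big_cat /= {}IH1 //; last by move=> G /setD1P[_]; exact: F0P.
rewrite [in RHS](big_setD1 F) //= [in RHS]addrCA addrC; congr (_ + _).
rewrite big_allpairs_dep /=.
rewrite (eq_bigr (fun i => 'X^i * fy_weight F)).
  rewrite -big_distrl /=; congr (_ * _).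
  rewrite /geom big_distrr /= -[1%N]addn0 iotaDl big_map -[X in iota 0 X]subn0.
  rewrite -/(index_iota 0 _) big_mkord; apply: eq_bigr => i _.
  by rewrite add1n exprS.
move=> i _; rewrite (fy_weight_rec fF).
have -> : 1 + \sum_(G | uflat k G && (F \proper G))
    'X * geom (rho k G - rho k F).-1 * fy_weight G = \sum_(b <- s2) 'X^(mdeg b).
  rewrite IH2 //; last by move=> G /setIdP[].
  congr (_ + _); apply: eq_bigl => G; rewrite inE.
  case FG: (F \proper G); rewrite ?andbF // !andbT.
  apply/idP/idP => [fG|]; last exact: (proj1 upP).
  by apply: (proj2 upP) FP fG (proper_sub FG).
rewrite big_distrr /=; apply: eq_bigr => b _.
by rewrite mdegD mdegMn mdeg1 mul1n exprD.
Qed.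

End Counting.

(** * Transfer to the given presentations *)

Section GradedTransfer.
Variables (m : nat) (S : {mpoly rat[m]} -> Prop).

Lemma in_ideal_gen p : S p -> in_ideal S p.
Proof.
move=> Sp; exists [:: (p, 1)]; split; last by rewrite big_seq1 mulr1.
by move=> t; rewrite inE => /eqP->.
Qed.

Lemma in_ideal_ideal : is_ideal (in_ideal S).
Proof.
split=> [|p q [s [Ss ->]] [t [St ->]]|p q [s [Ss ->]]].
- by exists [::]; split=> //; rewrite big_nil.
- exists (s ++ t); rewrite big_cat; split=> // u.
  by rewrite mem_cat => /orP[us|ut]; [exact: Ss | exact: St].
exists [seq (t.1, t.2 * q) | t <- s]; split=> [u /mapP[t /Ss St ->] //|].
by rewrite big_map mulr_suml; apply: eq_bigr => t _; rewrite mulrA.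
Qed.

Hypothesis homS : forall p, S p -> exists e, p \is e.-homog.

(** Allows the ungraded spanning result to be cut down to a single degree. *)
Lemma in_ideal_pihomog j p : in_ideal S p -> in_ideal S (pihomog mdeg j p).
Proof.
case=> s [Ss ->]; have idI := in_ideal_ideal.
rewrite linear_sum big_seq; apply: (ideal_sum idI) => t /Ss St.
have [e he] := homS St.
rewrite (pihomog_partitionE (mf := mdeg) (leqnn (msize t.2))) mulr_sumr linear_sum.
apply: (ideal_sum idI) => d _ /=.
have hd : t.1 * pihomog mdeg d t.2 \is (e + d).-homog.
  by apply: dhomogM => //; exact: pihomogP.
have [<-|ne] := eqVneq (e + d)%N j.
  by rewrite pihomog_dE //; apply: (ideal_mulr idI); exact: in_ideal_gen.
by rewrite (pihomog_ne0 ne hd); exact: ideal_mem0.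
Qed.

Variables (T : finType) (k : nat) (P : {set {set T}}).
Hypotheses (kT : (k <= #|T|)%N) (k_gt0 : (0 < k)%N) (upP : up_closed k P)
  (P0 : set0 \notin P).

Notation N := #|{set T}|.
Notation R := {mpoly rat[m]}.
Notation B := {mpoly rat[N]}.

Variables (xi : {set T} -> R) (theta : {rmorphism R -> B}).
Hypotheses (homxi : forall G, xi G \is 1.-homog)
  (relS : fy_rel k (in_ideal S) xi set0 P)
  (genS : forall p, exists2 q, gen xi P q & in_ideal S (p - q))
  (thetaZ : forall a p, theta (a *: p) = a *: theta p)
  (thetaP : forall K : B -> Prop, is_ideal K -> fy_rel0 k K (@xvar T) set0 P ->
     (forall p, S p -> K (theta p)) /\
     (forall G, G \in P -> K (theta (xi G) - xvar G))).

Lemma homog_mev (b : 'X_{1..N}) : mev xi b \is (mdeg b).-homog.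
Proof.
rewrite /mev /mmap1 mdegE.
elim/big_rec2: _ => [|i d p _ hp]; first exact: dhomog1.
by apply: dhomogM => //; have := dhomogMn (b i) (homxi (enum_val i)); rewrite mul1n.
Qed.

Lemma theta_mev (K : B -> Prop) (b : 'X_{1..N}) : is_ideal K -> fy_rel0 k K (@xvar T) set0 P ->
  (forall G, G \notin P -> b (enum_rank G) = 0%N) -> K (theta (mev xi b) - 'X_[b]).
Proof.
move=> idK relK bP; rewrite /mev /mmap1 rmorph_prod mpolyXE_id.
apply: (big_ind2 (fun x y => K (x - y))) => [|x x' y y' Kx Ky|i _].
- by rewrite subrr; exact: ideal_mem0.
- have -> : x * y - x' * y' = (x - x') * y + x' * (y - y').
    by rewrite mulrBl mulrBr addrA subrK.
  by apply: (ideal_add idK); [exact: ideal_mulr | exact: ideal_mull].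
case iP: (enum_val i \in P); last first.
  have := bP (enum_val i); rewrite iP enum_valK => -> //.
  by rewrite !expr0 rmorph1 subrr; exact: ideal_mem0.
rewrite rmorphXn subrXX; apply: ideal_mulr => //.
by have := (thetaP idK relK).2 _ iP; rewrite /xvar enum_valK.
Qed.

(** The basis consists of the standard monomials of degree j evaluated at [xi]. They are independent
    because a dual functional composed with [theta] vanishes on the ideal of S and, by [theta_mev],
    takes the same values on them as on the monomials. *)
Lemma graded_dim_transfer j : exists d, graded_dim S j d /\
  d%:R = (1 + \sum_(F in P) 'X * geom (rho k F).-1 * fy_weight k F)`_j.
Proof.
have idI := in_ideal_ideal.
have prP G : G \in P -> set0 \proper G.
  by move=> GP; rewrite proper0; apply: contraNneq P0 => <-.
have f0 : uflat k (set0 : {set T}) by rewrite /uflat cards0 k_gt0.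
have [s std] := fy_std_exists k prP.
have us := fy_std_uniq kT std.
pose sj := [seq b <- s | mdeg b == j].
have usj : uniq sj by exact: filter_uniq.
pose bt (t : 'I_(size sj)) := nth 0%MM sj t.
have bt_s t : bt t \in s.
  by have := mem_nth 0%MM (ltn_ord t); rewrite mem_filter => /andP[].
have bt_j t : mdeg (bt t) = j.
  by have := mem_nth 0%MM (ltn_ord t); rewrite mem_filter => /andP[/eqP].
have sumE (f : 'X_{1..N} -> R) : \sum_(t < size sj) f (bt t) = \sum_(b <- sj) f b.
  by rewrite (big_nth 0%MM) big_mkord.
exists (size sj); split; last first.
  have := fy_std_count kT std upP prP f0.
  rewrite /rho cards0 min0n; under [in RHS]eq_bigr do rewrite subn0.
  move=> <-; rewrite coef_sum /sj size_filter -sum1_count natr_sum big_mkcond.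
  by apply: eq_bigr => b _; rewrite coefXn eq_sym; case: eqP.
exists (fun t => mev xi (bt t)); split.
- by move=> t; rewrite -(bt_j t); exact: homog_mev.
- move=> p hp; have [q gq Iq] := genS p.
  have /spanned_coef := fy_std_span kT std upP prP f0 idI relS gq.
  case/(_ idI us) => c Ic; exists (fun t => c (bt t)).
  have {}Ic : in_ideal S (p - \sum_(b <- s) c b *: mev xi b).
    by rewrite -(subrK q p) -addrA; exact: ideal_add.
  have := in_ideal_pihomog j Ic; rewrite linearB /= pihomog_dE //.
  have -> // : pihomog mdeg j (\sum_(b <- s) c b *: mev xi b)
      = \sum_t c (bt t) *: mev xi (bt t).
  rewrite (sumE (fun b => c b *: mev xi b)) /sj big_filter [RHS]big_mkcond linear_sum.
  apply: eq_bigr => b _; rewrite linearZ /=; case: eqP => [<-|/eqP ne].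
    by rewrite pihomog_dE ?homog_mev.
  by rewrite (pihomog_ne0 ne (homog_mev b)) scaler0.
move=> c Ic t.
have [lam [addl scl] [rell dual]] := fy_std_dual kT std upP prP f0 (bt_s t).
have idK := kills_ideal addl.
have [kS _] := thetaP idK rell.
have lam0 q : kills lam q -> lam q = 0 by move=> kq; rewrite -[q]mulr1 kq.
have lam_theta q : in_ideal S q -> lam (theta q) = 0.
  case=> u [Su ->]; apply: lam0; rewrite rmorph_sum big_seq /=.
  apply: (ideal_sum idK) => v /Su Sv; rewrite rmorphM.
  by apply: (ideal_mulr idK); exact: kS.
have lam_mev t' : lam (theta (mev xi (bt t'))) = (t' == t)%:R.
  have supp G : G \notin P -> bt t' (enum_rank G) = 0%N.
    by move=> GP; exact: (fy_std_supp std (bt_s t') GP).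
  have /lam0 := theta_mev idK rell supp; rewrite addfunB // => /eqP.
  rewrite subr_eq0 => /eqP->; rewrite dual //; congr (nat_of_bool _)%:R.
  by rewrite /bt nth_uniq.
have := lam_theta _ Ic; rewrite rmorph_sum addfun_sum //= (bigD1 t) //= big1.
  by rewrite thetaZ scl lam_mev eqxx mulr1 addr0.
by move=> t' /negbTE ne; rewrite thetaZ scl lam_mev ne mulr0.
Qed.

End GradedTransfer.

(** * Power relations deduced from linear relations at points *)

Section LinearRelations.
Variables (T : finType) (k : nat) (P : {set {set T}}).
Hypotheses (upP : up_closed k P) (k_gt0 : (0 < k)%N).
Variables (R : comNzRingType) (I : R -> Prop) (xi : {set T} -> R).
Hypotheses (idI : is_ideal I)
  (xi_out : forall G, uflat k G -> G \notin P -> I (xi G))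
  (xi_incomp : forall G H, G \in P -> H \in P -> incomp G H -> I (xi G * xi H))
  (lin_out : forall H a, H \in P -> a \notin H -> I (xi H * hsum k xi [set a]))
  (lin_in : forall S, S \in P -> exists2 a, a \in S & I (hsum k xi [set a])).
Implicit Types (G H S : {set T}).

(** Trades one factor [hsum S] for the sum over all flats through a, which x kills, minus the flats
    through a that do not contain S. *)
Lemma hsumX_step x S a e : a \in S -> I (x * hsum k xi [set a]) ->
  (forall G, G \in P -> a \in G -> ~~ (S \subset G) -> I (x * (xi G * hsum k xi S ^+ e))) ->
  I (x * hsum k xi S ^+ e.+1).
Proof.
move=> aS Ia IG; pose u := \sum_(G | uflat k G && (a \in G) && ~~ (S \subset G)) xi G.
have -> : hsum k xi S ^+ e.+1 = hsum k xi [set a] * hsum k xi S ^+ e - u * hsum k xi S ^+ e.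
  rewrite -mulrBl exprS; congr (_ * _); rewrite {2}/hsum (bigID (fun G => S \subset G)) /=.
  rewrite [X in _ = _ + X - _](eq_bigl (fun G => uflat k G && (a \in G) && ~~ (S \subset G))).
    rewrite addrK; apply: eq_bigl => G; rewrite sub1set -andbA; congr (_ && _).
    by case SG: (S \subset G); rewrite ?andbF ?andbT // (subsetP SG).
  by move=> G; rewrite sub1set.
rewrite mulrBr mulrA; apply: (ideal_sub idI); first exact: ideal_mulr.
rewrite mulr_suml mulr_sumr; apply: (ideal_sum idI) => G /andP[/andP[fG aG] SG].
have [GP|nGP] := boolP (G \in P); first exact: IG.
by apply: ideal_mull => //; apply: ideal_mulr => //; exact: xi_out.
Qed.

(** Choose a in S outside H. The flats G left by [hsumX_step] matter only if they lie strictly above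
    H; such a G meets S in more points, so the rank still missing drops by one. For e = 0 the
    hypotheses contradict that H is a flat. *)
Lemma lin_hsumX e H S : H \in P -> ~~ (S \subset H) ->
  (rho k (S :|: H) - rho k H <= e)%N -> I (xi H * hsum k xi S ^+ e).
Proof.
elim: e => [|e IHe] in H * => HP SH le.
  have HSH : H \proper S :|: H by rewrite properE subsetUr subUset subxx andbT.
  have := uflat_proper (proj1 upP _ HP) HSH; have := proper_card HSH.
  by move: le; rewrite /rho; lia.
have /subsetPn[a aS aH] := SH; apply: (hsumX_step aS); first exact: lin_out.
move=> G GP aG SG; have [GH|GH] := boolP (G \subset H).
  by rewrite (subsetP GH) in aH.
have [HG|HG] := boolP (H \subset G); last first.
  by rewrite mulrA; apply: ideal_mulr => //; apply: xi_incomp; rewrite // /incomp HG.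
apply: ideal_mull => //; apply: IHe => //.
have Gk : (#|G| < k)%N.
  have := proj1 upP _ GP; case/orP=> // /eqP eG; by rewrite eG subsetT in SG.
have lt : (#|S :&: H| < #|S :&: G|)%N.
  apply: proper_card; rewrite properE setIS //=; apply/subsetPn; exists a.
    by rewrite inE aS.
  by rewrite inE negb_and aH orbT.
have := cardsUI S G; have := cardsUI S H; have := subset_leq_card HG.
have := subset_leq_card (subsetIr S G); have := subset_leq_card (subsetIl S G).
have: (#|H| < #|G|)%N by apply: proper_card; rewrite properE HG GH.
move: le; rewrite /rho; lia.
Qed.

(** For the powers of [hsum S] alone, start from a point a of S whose sum vanishes: every G through
    a already meets S, so [rho S] - 1 further factors suffice. *)
Lemma lin_fy_rel : fy_rel k I xi set0 P.
Proof.
split=> // [S SP|H S HP SP HS].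
  have [a aS Ia] := lin_in SP.
  have S0 : (0 < #|S|)%N by apply/card_gt0P; exists a.
  have -> : (rho k S - rho k (set0 : {set T}) = (rho k S).-1.+1)%N.
    by rewrite /rho cards0; lia.
  rewrite -[_ ^+ _]mul1r; apply: (hsumX_step aS) => [|G GP aG SG]; first by rewrite mul1r.
  rewrite mul1r; apply: lin_hsumX => //.
  have Gk : (#|G| < k)%N.
    have := proj1 upP _ GP; case/orP=> // /eqP eG; by rewrite eG subsetT in SG.
  have : (0 < #|S :&: G|)%N by apply/card_gt0P; exists a; rewrite inE aS.
  have := cardsUI S G; have := subset_leq_card (subsetIr S G).
  have := subset_leq_card (subsetIl S G); rewrite /rho; lia.
apply: lin_hsumX => //; first by case/andP: HS.
by rewrite (setUidPl (proper_sub HS)).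
Qed.

End LinearRelations.

(** * Presentations without a variable for the ground set *)

Section Presentation.
Variables (T : finType) (k : nat) (P : {set {set T}}) (a0 : T).
Hypotheses (kT : (k <= #|T|)%N) (k_gt0 : (0 < k)%N) (upP : up_closed k P)
  (P0 : set0 \notin P) (a0P : ucl k [set a0] \in P).
Variables (r : nat) (fl : 'I_r -> {set T}).
Hypotheses (fl_inj : injective fl) (fl_im : fl @: setT = P :\ setT).
Variables (m : nat) (S : {mpoly rat[m]} -> Prop) (v : 'I_r -> {mpoly rat[m]}).

Notation N := #|{set T}|.
Notation R := {mpoly rat[m]}.
Notation B := {mpoly rat[N]}.

Definition vsum a : R := \sum_(i | a \in fl i) v i.

(* The presentations of [Defs] have no variable for the ground set: its role is
   played by [- vsum a0]. *)
Definition pxi (G : {set T}) : R :=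
  if G == setT then - vsum a0 else \sum_(i | fl i == G) v i.

Lemma flP i : fl i \in P /\ fl i != setT.
Proof.
have : fl i \in P :\ setT by rewrite -fl_im imset_f.
by case/setD1P.
Qed.

Lemma fl_ex G : G \in P -> G != setT -> exists i, G = fl i.
Proof.
move=> GP GT; have : G \in fl @: setT by rewrite fl_im !inE GT.
by case/imsetP => i _ ->; exists i.
Qed.

Lemma pxi_fl i : pxi (fl i) = v i.
Proof.
rewrite /pxi (negbTE (flP i).2) (big_pred1 i) // => j.
by rewrite /= (inj_eq fl_inj).
Qed.

Lemma setTP : setT \in P.
Proof. by apply: (proj2 upP) a0P _ (subsetT _); rewrite /uflat eqxx orbT. Qed.

Lemma pxi_out G : G \notin P -> pxi G = 0.
Proof.
move=> GP; rewrite /pxi; case: eqP => [eG|_]; first by rewrite eG setTP in GP.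
by rewrite big1 // => i /eqP eG; rewrite -eG (flP i).1 in GP.
Qed.

Lemma sum_fl (V : nmodType) (Q : pred {set T}) (f : {set T} -> V) :
  \sum_(G in P | (G != setT) && Q G) f G = \sum_(i | Q (fl i)) f (fl i).
Proof.
rewrite (eq_bigl (fun G => (G \in fl @: setT) && Q G)); last first.
  by move=> G; rewrite fl_im !inE andbA [(G != _) && _]andbC.
rewrite big_mkcondr big_imset /=; last by move=> ? ? _ _; exact: fl_inj.
by rewrite -big_mkcondr; apply: eq_bigl => i; rewrite inE.
Qed.

Lemma hsum_split (V : comNzRingType) (x : {set T} -> V) A :
  hsum k x A = x setT + \sum_(i | A \subset fl i) x (fl i)
    + \sum_(G | uflat k G && (A \subset G) && (G \notin P)) x G.
Proof.
rewrite /hsum (bigID (fun G => G \in P)) /=; congr (_ + _).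
rewrite (bigD1 setT) /=; last by rewrite /uflat eqxx orbT subsetT setTP.
congr (_ + _); rewrite -(sum_fl (fun G => A \subset G) x); apply: eq_bigl => G.
case GP: (G \in P); rewrite ?andbF //= andbT (proj1 upP _ GP) /=.
by rewrite andbC.
Qed.

Lemma hsum_pxi A : hsum k pxi A = \sum_(i | A \subset fl i) v i - vsum a0.
Proof.
rewrite hsum_split [X in _ + X]big1 => [|G /andP[_ /pxi_out] //].
rewrite addr0 addrC {2}/pxi eqxx; congr (_ - _).
by apply: eq_bigr => i _; rewrite pxi_fl.
Qed.

(** By the choice of [pxi setT] the sum at a0 is zero, so the sums at points are the linear
    relations of the Chow ring. *)
Lemma hsum_pxi1 a : hsum k pxi [set a] = vsum a - vsum a0.
Proof. by rewrite hsum_pxi; congr (_ - _); apply: eq_bigl => i; rewrite sub1set. Qed.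

Variable theta : {rmorphism R -> B}.
Hypotheses (homS : forall p, S p -> exists e, p \is e.-homog)
  (homv : forall i, v i \is 1.-homog)
  (S_incomp : forall i j, incomp (fl i) (fl j) -> in_ideal S (v i * v j))
  (S_out : forall a i, a \notin fl i -> in_ideal S (v i * (vsum a - vsum a0)))
  (S_in : forall A, A \in P -> exists2 a, a \in A & in_ideal S (vsum a - vsum a0))
  (genX : forall i : 'I_m, exists2 q, gen pxi P q & in_ideal S ('X_i - q))
  (thetaZ : forall a p, theta (a *: p) = a *: theta p)
  (thetav : forall i, theta (v i) = xvar (fl i))
  (thetaS : forall K : B -> Prop, is_ideal K -> fy_rel0 k K (@xvar T) set0 P ->
     forall p, S p -> K (theta p)).

Lemma pxi_fy_rel : fy_rel k (in_ideal S) pxi set0 P.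
Proof.
have idI := in_ideal_ideal S.
apply: (lin_fy_rel upP k_gt0 idI) => [G _ GP|G H GP HP inc|H a HP aH|A AP].
- by rewrite pxi_out //; exact: ideal_mem0.
- have GT : G != setT by apply: contraTneq inc => ->; rewrite /incomp subsetT andbF.
  have HT : H != setT by apply: contraTneq inc => ->; rewrite /incomp subsetT.
  have [i eG] := fl_ex GP GT; have [j eH] := fl_ex HP HT.
  by rewrite eG eH !pxi_fl; apply: S_incomp; rewrite -eG -eH.
- have HT : H != setT by apply: contraNneq aH => ->; rewrite inE.
  have [i eH] := fl_ex HP HT.
  by rewrite eH hsum_pxi1 pxi_fl; apply: S_out; rewrite -eH.
by have [a aA Ia] := S_in AP; exists a; rewrite ?hsum_pxi1.
Qed.

Lemma gen_all p : exists2 q, gen pxi P q & in_ideal S (p - q).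
Proof.
have idI := in_ideal_ideal S.
have genM x y : (exists2 q, gen pxi P q & in_ideal S (x - q)) ->
    (exists2 q, gen pxi P q & in_ideal S (y - q)) ->
    exists2 q, gen pxi P q & in_ideal S (x * y - q).
  move=> [q gq Iq] [q' gq' Iq']; exists (q * q'); first exact: gen_mul.
  have -> : x * y - q * q' = (x - q) * y + q * (y - q').
    by rewrite mulrBl mulrBr addrA subrK.
  by apply: (ideal_add idI); [exact: ideal_mulr | exact: ideal_mull].
have genC c : exists2 q, gen pxi P q & in_ideal S (c%:MP - q).
  by exists c%:MP; [exact: gen_const | rewrite subrr; exact: ideal_mem0].
rewrite [p]mpolyE; apply: (big_ind (fun x => exists2 q, gen pxi P q & in_ideal S (x - q))).
- by have := genC 0; rewrite mpolyC0.
- move=> x y [q gq Iq] [q' gq' Iq']; exists (q + q'); first exact: gen_add.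
  by rewrite opprD addrACA; exact: ideal_add.
move=> b _; rewrite -mul_mpolyC; apply: (genM _ _); first exact: genC.
rewrite mpolyXE_id; apply: (big_ind (fun x => exists2 q, gen pxi P q & in_ideal S (x - q))).
- by have := genC 1; rewrite mpolyC1.
- exact: genM.
move=> i _; elim: (b i) => [|e IHe]; first by have := genC 1; rewrite mpolyC1.
by rewrite exprS; apply: (genM _ _).
Qed.

(** The closure of a point has rank 1, so its power relation is itself linear; this recovers the
    linear relations from [fy_rel0]. *)
Lemma rel0_vsum K a : is_ideal K -> fy_rel0 k K (@xvar T) set0 P ->
  ucl k [set a] \in P -> K (\sum_(i | a \in fl i) xvar (fl i) + xvar setT).
Proof.
move=> idK relK aP; have Ka : K (hsum k (@xvar T) [set a]).
  rewrite -(hsum_ucl kT) -[X in K X]expr1; case: relK => [[_ h _] _].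
  apply: (ideal_congr idK _ (h _ aP)); rewrite (rho_ucl kT) /rho cards1 cards0 min0n subn0.
  by rewrite (minn_idPl k_gt0) subrr; exact: ideal_mem0.
have -> : \sum_(i | a \in fl i) xvar (fl i) =
    \sum_(i | [set a] \subset fl i) xvar (fl i) :> B.
  by apply: eq_bigl => i; rewrite sub1set.
rewrite addrC; apply: (ideal_congr idK _ Ka); rewrite hsum_split.
rewrite opprD addrA subrr add0r; apply: ideal_opp => //.
by apply: (ideal_sum idK) => H /andP[_ HP]; exact: (proj2 relK).
Qed.

Lemma presentation_dim j : exists d, graded_dim S j d /\
  d%:R = (1 + \sum_(F in P) 'X * geom (rho k F).-1 * fy_weight k F)`_j.
Proof.
apply: (graded_dim_transfer homS kT k_gt0 upP P0 (xi := pxi) (theta := theta)) => //.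
- move=> G; rewrite /pxi.
  by case: eqP => _; rewrite ?rpredN; apply: rpred_sum => i _; exact: homv.
- exact: pxi_fy_rel.
- exact: gen_all.
move=> K idK relK; split; first exact: thetaS.
move=> G GP; have [->|GT] := eqVneq G setT; last first.
  have [i ->] := fl_ex GP GT; rewrite pxi_fl thetav subrr; exact: ideal_mem0.
rewrite /pxi eqxx rmorphN -opprD; apply: ideal_opp => //.
rewrite rmorph_sum /= (eq_bigr _ (fun i _ => thetav i)); exact: rel0_vsum.
Qed.

End Presentation.

Lemma subset_card_between (T : finType) (A C : {set T}) k :
  A \subset C -> (#|A| <= k)%N -> (k <= #|C|)%N ->
  exists X : {set T}, [/\ A \subset X, X \subset C & #|X| = k].
Proof.
move=> AC Ak kC.
have : (0 < #|[set Y : {set T} | Y \subset C :\: A & #|Y| == k - #|A|]|)%N.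
  by rewrite cards_draws bin_gt0 cardsDS // leq_sub2r.
case/card_gt0P => Y; rewrite inE subsetD => /andP[/andP[YC YA] /eqP cY].
exists (A :|: Y); split; first exact: subsetUl.
  by rewrite subUset AC.
move: YA; rewrite disjoint_sym => /disjoint_setI0 AY.
by rewrite cardsU AY cards0 subn0 cY subnKC.
Qed.

Lemma dhomog_var m (i : 'I_m) : ('X_i : {mpoly rat[m]}) \is 1.-homog.
Proof. by rewrite dhomogX; apply/eqP; exact: mdeg1. Qed.

Section UniformFlats.
Variables (n k : nat).
Hypothesis kn : (k <= n)%N.

Lemma mrank_uniform S : mrank (uniform_bases k n) S = rho k S.
Proof.
apply/eqP; rewrite eqn_leq; apply/andP; split.
  apply/bigmax_leqP => X; rewrite inE => /eqP cX.
  by rewrite /rho leq_min subset_leq_card ?subsetIl //= -cX subset_leq_card ?subsetIr.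
have [X [AX XC cX]] : exists X : {set 'I_n},
    [/\ S \subset X \/ X \subset S, true & #|X| = k].
  have [Sk|kS] := leqP #|S| k.
    have := subset_card_between (subsetT S) Sk; rewrite cardsT card_ord.
    by move=> /(_ kn)[X [SX _ cX]]; exists X; split; [left | |].
  have := subset_card_between (sub0set S) (k := k); rewrite cards0.
  by move=> /(_ isT (ltnW kS))[X [_ XS cX]]; exists X; split; [right | |].
apply: (bigmax_sup X); first by rewrite inE cX.
by case: AX => [/setIidPl->|/setIidPr->]; rewrite ?cX /rho ?geq_minl ?geq_minr.
Qed.

Lemma is_flat_uniform F : is_flat (uniform_bases k n) F = uflat k F.
Proof.
apply/forallP/idP => [h|/orP[Fk e|/eqP-> e]]; last by rewrite inE.
  rewrite /uflat; case: ltnP => //= kF; apply/eqP/setP => e; rewrite inE.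
  apply/negbNE/negP => eF; have := h e; rewrite eF /= !mrank_uniform /rho.
  by rewrite (minn_idPr kF) leq_min ltnn andbF.
by apply/implyP => eF; rewrite !mrank_uniform /rho cardsU1 eF; lia.
Qed.

End UniformFlats.

(** * The Chow ring *)

Section Reduced.
Variables (n k : nat).
Hypotheses (k_gt0 : (0 < k)%N) (kn : (k <= n)%N).

Notation M := (uniform_bases k n).
Notation P := [set F : {set 'I_n} | uflat k F & F != set0].
Let kT : (k <= #|'I_n|)%N. Proof. by rewrite card_ord. Qed.
Let a0 : 'I_n := Ordinal (leq_trans k_gt0 kn).

Let upP : up_closed k P.
Proof.
split=> [F|F G]; rewrite !inE; first by case/andP.
case/andP=> _ F0 -> FG /=; apply: contraNneq F0 => G0.
by rewrite -subset0 -G0.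
Qed.

Let P0 : set0 \notin P. Proof. by rewrite inE eqxx andbF. Qed.

Let ucl1P a : ucl k [set a] \in P.
Proof.
rewrite inE uflat_cl /=; apply/set0Pn; exists a.
by apply: (subsetP (sub_ucl _ _)); rewrite inE.
Qed.

Lemma pflat_inj : injective (@pflat n M).
Proof. exact: enum_val_inj. Qed.

Lemma pflat_im : @pflat n M @: setT = P :\ setT.
Proof.
apply/setP => F; rewrite !inE; apply/imsetP/idP => [[i _ ->]|/and3P[FT fF F0]].
  have := enum_valP i; rewrite inE is_flat_uniform // => /and3P[fF F0 FT].
  by rewrite FT fF F0.
have FM : F \in pflats M by rewrite inE is_flat_uniform // fF F0.
by exists (enum_rank_in FM F); rewrite // /pflat enum_rankK_in.
Qed.

Definition red_hom : {rmorphism {mpoly rat[#|pflats M|]} -> {mpoly rat[#|{set 'I_n}|]}} :=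
  mmap (@mpolyC _ rat) (fun i => xvar (pflat i)).

Lemma reduced_dim j : exists d, graded_dim (red_gens M) j d /\
  d%:R = (chow_poly n k)`_j.
Proof.
have -> : chow_poly n k = 1 + \sum_(F in P) 'X * geom (rho k F).-1 * fy_weight k F.
  have := @fy_weight_rec _ k kT set0; rewrite /uflat cards0 k_gt0 => /(_ isT).
  rewrite {1}/fy_weight cards0 card_ord !subn0.
  rewrite (negbTE (_ : set0 != setT)); last first.
    by apply/eqP => /setP/(_ a0); rewrite !inE.
  move=> ->; rewrite /rho cards0 min0n; congr (_ + _); apply: eq_big => F.
    by rewrite inE proper0.
  by rewrite subn0.
have idI := in_ideal_ideal (red_gens M).
have linI a b : in_ideal (red_gens M)
    (vsum (@pflat n M) (fun i => 'X_i) a - vsum (@pflat n M) (fun i => 'X_i) b).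
  by apply: in_ideal_gen; right; exists a, b.
apply: (presentation_dim kT k_gt0 upP P0 (ucl1P a0) pflat_inj pflat_im
   (v := fun i => 'X_i) (theta := red_hom)).
- move=> p [[i [l [_ ->]]]|[a [b ->]]].
    by exists 2%N; apply: (dhomogM (d := 1) (e := 1)); exact: dhomog_var.
  by exists 1%N; apply: rpredB; apply: rpred_sum => i _; exact: dhomog_var.
- by move=> i; exact: dhomog_var.
- by move=> i l inc; apply: in_ideal_gen; left; exists i, l.
- by move=> a i _; apply: ideal_mull.
- move=> A; rewrite inE => /andP[_ /set0Pn[a aA]]; exists a => //.
- move=> i; exists 'X_i; last by rewrite subrr; exact: ideal_mem0.
  rewrite -(pxi_fl a0 pflat_inj pflat_im (fun i => 'X_i)); apply: gen_var.
  exact: (flP pflat_im i).1.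
- by move=> a p; rewrite [LHS]mmapZ mul_mpolyC.
- by move=> i; rewrite [LHS]mmapX mmap1U.
move=> K idK relK p [[i [l [inc ->]]]|[a [b ->]]].
  by rewrite rmorphM /= !mmapX !mmap1U; exact: (rel0_incomp idK relK).
(* Each point yields the same variable of the ground set, which cancels in the difference. *)
have K1 c := rel0_vsum kT k_gt0 upP (ucl1P a0) pflat_inj pflat_im idK relK (ucl1P c).
have := ideal_sub idK (K1 a) (K1 b); rewrite opprD addrACA subrr addr0.
by rewrite rmorphB !rmorph_sum; congr (K (_ - _)); apply: eq_bigr => i _;
   rewrite /= mmapX mmap1U.
Qed.

End Reduced.

(** * The augmented Chow ring *)

Section Augmented.
Variables (n k : nat).
Hypotheses (k_gt0 : (0 < k)%N) (kn : (k <= n)%N).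

Notation M := (uniform_bases k n).
Notation T := (option 'I_n).
Notation P := [set G : {set option 'I_n} | uflat k.+1 G & None \in G].

(* The augmented Chow ring of rank [k] on ['I_n] has the relations of the flats
   of rank [k.+1] on [option 'I_n] that contain [None]; [yv a] corresponds to
   [- hsum [set Some a]]. *)
Definition cone (F : {set 'I_n}) : {set T} := None |: Some @: F.

Lemma mem_cone_some F a : (Some a \in cone F) = (a \in F).
Proof. by rewrite !inE /= mem_imset // => x y []. Qed.

Lemma mem_cone_none F : None \in cone F.
Proof. by rewrite !inE. Qed.

Lemma card_cone F : #|cone F| = #|F|.+1.
Proof.
rewrite cardsU1 (_ : None \notin _); last by apply/imsetP => -[].
by rewrite card_imset // => x y [].
Qed.

Lemma cone_sub F G : (cone F \subset cone G) = (F \subset G).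
Proof.
apply/subsetP/subsetP => sub a.
  by have := sub (Some a); rewrite !mem_cone_some.
by case: a => [a|]; rewrite ?mem_cone_none // !mem_cone_some; exact: sub.
Qed.

Lemma cone_inj : injective cone.
Proof.
move=> F G e; apply/setP => a.
by rewrite -!mem_cone_some e.
Qed.

Lemma coneT : cone setT = setT.
Proof. by apply/setP => -[a|]; rewrite ?mem_cone_none ?mem_cone_some !inE. Qed.

Lemma cone_preim (G : {set T}) : None \in G -> G = cone (Some @^-1: G).
Proof. by move=> GN; apply/setP => -[a|]; rewrite ?mem_cone_none ?mem_cone_some ?inE. Qed.

Lemma uflat_cone F : uflat k.+1 (cone F) = uflat k F.
Proof. by rewrite /uflat card_cone ltnS -coneT (inj_eq cone_inj). Qed.

Let kT : (k.+1 <= #|{: T}|)%N. Proof. by rewrite card_option card_ord. Qed.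

Let upP : up_closed k.+1 P.
Proof.
split=> [F|F G]; rewrite !inE; first by case/andP.
by case/andP=> _ FN -> FG; exact: (subsetP FG).
Qed.

Let P0 : set0 \notin P. Proof. by rewrite !inE andbF. Qed.

Let uclP : ucl k.+1 [set None] \in P.
Proof. by rewrite inE uflat_cl (subsetP (sub_ucl _ _)) ?inE. Qed.

Definition acone (i : 'I_#|aflats M|) : {set T} := cone (aflat i).

Lemma acone_inj : injective acone.
Proof. by move=> i j /cone_inj/enum_val_inj. Qed.

Lemma acone_im : acone @: setT = P :\ setT.
Proof.
apply/setP => G; rewrite !inE; apply/imsetP/idP => [[i _ ->]|/and3P[GT fG GN]].
  have := enum_valP i; rewrite inE is_flat_uniform // => /andP[fF FT].
  rewrite /acone /aflat uflat_cone fF mem_cone_none !andbT.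
  by rewrite -coneT (inj_eq cone_inj).
have eG := cone_preim GN; set F := Some @^-1: G in eG.
have FM : F \in aflats M.
  rewrite inE is_flat_uniform // -uflat_cone -eG fG /=.
  by rewrite -(inj_eq cone_inj) -eG coneT.
by exists (enum_rank_in FM F); rewrite // /acone /aflat enum_rankK_in.
Qed.

Definition aug_hom : {rmorphism {mpoly rat[#|aflats M| + n]} -> {mpoly rat[#|{set T}|]}} :=
  mmap (@mpolyC _ rat) (fun z => match split z with
    | inl i => xvar (acone i)
    | inr a => \sum_(i | Some a \notin acone i) xvar (acone i) end).

Lemma aug_hom_xv i : aug_hom (xv i) = xvar (acone i).
Proof. by rewrite /aug_hom /= mmapX mmap1U (unsplitK (inl i)). Qed.

Lemma aug_hom_yv a :
  aug_hom (yv M a) = \sum_(i | Some a \notin acone i) xvar (acone i).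
Proof. by rewrite /aug_hom /= mmapX mmap1U (unsplitK (inr a)). Qed.

Lemma aug_poly_sum :
  aug_poly n k = 1 + \sum_(F in P) 'X * geom (rho k.+1 F).-1 * fy_weight k.+1 F.
Proof.
rewrite aug_poly_rec geomS -addrA; congr (_ + _).
rewrite (bigD1 setT) /=; last by rewrite !inE /uflat eqxx orbT.
rewrite (rhoT kT) /= {1}/fy_weight eqxx mulr1; congr (_ + _).
pose phi s := if (s < k)%N then 'X * geom s * chow_poly (n - s) (k - s) else 0.
have cT : (#|{: T}| - #|[set None : T]|)%N = n by rewrite card_option card_ord cards1 subn1.
transitivity (\sum_(s < n.+1) phi s *+ 'C(n, s)).
  rewrite (big_ord_widen _
    (fun s => ('X * geom s * chow_poly (n - s) (k - s)) *+ 'C(n, s)) (leqW kn)).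
  rewrite big_mkcond; apply: eq_bigr => s _.
  by rewrite /phi; case: ifP; rewrite ?mul0rn.
have := @sum_supsets _ _ [set None : T] phi; rewrite cT => <-.
rewrite big_mkcond [RHS]big_mkcond /=; apply: eq_bigr => G _.
rewrite sub1set cards1 !inE; case GN: (None \in G); last by rewrite andbF.
have G0 : (0 < #|G|)%N by apply/card_gt0P; exists None.
have [->|nGT] := eqVneq G setT.
  rewrite andbF /phi cardsT card_option card_ord subn1 /=; case: ifP => //; lia.
rewrite !andbT /uflat (negbTE nGT) orbF /phi.
have -> : (#|G| - 1 < k)%N = (#|G| < k.+1)%N by rewrite subn1 -ltnS prednK.
case: ifP => // Gk; rewrite (rho_proper Gk) /fy_weight (negbTE nGT) subn1.
by congr (_ * chow_poly _ _); rewrite ?card_option ?card_ord; case: #|G| G0 => // c _;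
  rewrite subSS.
Qed.

Lemma augmented_dim j : exists d, graded_dim (aug_gens M) j d /\
  d%:R = (aug_poly n k)`_j.
Proof.
rewrite aug_poly_sum; have idI := in_ideal_ideal (aug_gens M).
have vsumN : vsum acone (@xv n M) None = \sum_i xv i.
  by apply: eq_bigl => i; rewrite mem_cone_none.
have vsumS a : vsum acone (@xv n M) (Some a) - vsum acone (@xv n M) None =
    - \sum_(i | a \notin aflat i) xv i.
  rewrite vsumN (bigID (fun i => a \in aflat i)) /= opprD addrA.
  rewrite /vsum (eq_bigl (fun i => a \in aflat i)) ?subrr ?add0r // => i.
  exact: mem_cone_some.
have homx i : @xv n M i \is 1.-homog by exact: dhomog_var.
have homy a : yv M a \is 1.-homog by exact: dhomog_var.
apply: (presentation_dim kT (ltn0Sn k) upP P0 uclP acone_inj acone_im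
   (v := @xv n M) (theta := aug_hom)) => //.
- move=> p [[a ->]|[[i [l [_ ->]]]|[a [i [_ ->]]]]].
  + exists 1%N; apply: rpredB; first exact: homy.
    by apply: rpred_sum => i _; exact: homx.
  + by exists 2%N; apply: (dhomogM (d := 1) (e := 1)).
  by exists 2%N; apply: (dhomogM (d := 1) (e := 1)).
- move=> i l; rewrite /incomp !cone_sub => inc.
  by apply: in_ideal_gen; right; left; exists i, l.
- move=> [a|] i; last by rewrite mem_cone_none.
  rewrite mem_cone_some vsumS => ai.
  have -> : xv i * - (\sum_(i | a \notin aflat i) xv i) =
      (yv M a - \sum_(i | a \notin aflat i) xv i) * xv i - yv M a * xv i.
    by rewrite mulrBl addrAC subrr add0r mulrN mulrC.
  apply: (ideal_sub idI); last by apply: in_ideal_gen; right; right; exists a, i.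
  by apply: ideal_mulr => //; apply: in_ideal_gen; left; exists a.
(* The extra point is both the reference point and a member of A, so the difference is zero. *)
- move=> A; rewrite inE => /andP[_ AN]; exists None => //.
  by rewrite subrr; exact: ideal_mem0.
- have genx i : gen (pxi None acone (@xv n M)) P (xv i).
    rewrite -(pxi_fl None acone_inj acone_im (@xv n M)); apply: gen_var.
    exact: (flP acone_im i).1.
  move=> z; case: (split_ordP z) => [i ->|a ->].
    by exists (xv i); rewrite ?subrr; [exact: genx | exact: ideal_mem0].
  exists (\sum_(i | a \notin aflat i) xv i); first exact: gen_sum.
  by apply: in_ideal_gen; left; exists a.
- by move=> a p; rewrite [LHS]mmapZ mul_mpolyC.
- exact: aug_hom_xv.
move=> K idK relK p [[a ->]|[[i [l [inc ->]]]|[a [i [ai ->]]]]].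
- rewrite rmorphB rmorph_sum aug_hom_yv (_ : _ - _ = 0); first exact: ideal_mem0.
  apply/eqP; rewrite subr_eq0; apply/eqP; apply: eq_big => i; rewrite ?aug_hom_xv //.
  by rewrite mem_cone_some.
- rewrite rmorphM !aug_hom_xv; apply: (rel0_incomp idK relK).
  by rewrite /incomp !cone_sub.
rewrite rmorphM aug_hom_xv aug_hom_yv.
(* [K1] is the sum of all variables, [K2] the product of the variable of i with the sum over flats
   containing a. Multiplying [K1] by this variable and subtracting leaves the flats avoiding a,
   which is the image of [yv M a * xv i]. *)
have K1 := rel0_vsum kT (ltn0Sn k) upP uclP acone_inj acone_im idK relK uclP.
have iP := (flP acone_im i).1.
have K2 : K (xvar (acone i) * hsum k.+1 (@xvar T) [set Some a]).
  rewrite -[hsum _ _ _]expr1; apply: (rel0_hsumX kT idK upP relK iP).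
    by rewrite sub1set mem_cone_some.
  by rewrite /rho cardsU1 mem_cone_some ai; lia.
have K3 : K (xvar (acone i) *
    (xvar setT + \sum_(l | [set Some a] \subset acone l) xvar (acone l))).
  move: K2; rewrite (hsum_split upP uclP acone_inj acone_im) mulrDr.
  move/(ideal_congr idK); apply.
  rewrite opprD addrA subrr add0r; apply: ideal_opp => //; apply: ideal_mull => //.
  by apply: (ideal_sum idK) => H /andP[_ HP]; exact: (proj2 relK).
have := ideal_sub idK (ideal_mull idK (xvar (acone i)) K1) K3; rewrite -mulrBr mulrC.
congr (K (_ * _)); rewrite [xvar setT + _]addrC opprD addrACA subrr addr0.
rewrite (eq_bigl xpredT) => [|l]; last by rewrite mem_cone_none.
rewrite (bigID (fun l => Some a \in acone l)) /= addrAC.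
rewrite (eq_bigl (fun l => [set Some a] \subset acone l)) ?subrr ?add0r // => l.
by rewrite sub1set.
Qed.

End Augmented.

Theorem theorem1p9 (n k : nat) (hk1 : (1 <= k)%N) (hkn : (k <= n)%N) :
  (forall j : nat, exists d : nat,
     graded_dim (red_gens (uniform_bases k n)) j d /\
     (d%:R : rat) =
       (\sum_(j0 < k) ('C(n, j0))%:R *: (derangement j0 * geom (k - 1 - j0).+1))`_j)
  /\
  (forall j : nat, exists d : nat,
     graded_dim (aug_gens (uniform_bases k n)) j d /\
     (d%:R : rat) =
       (1 + 'X * \sum_(j0 < k) ('C(n, j0))%:R *: (eulerian j0 * geom (k - 1 - j0).+1))`_j).
Proof.
split=> j; first exact: reduced_dim.
exact: augmented_dim.
Qed.
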